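(* Let $\mu$ be a non-atomic measure on $\Sigma$ or the counting measure on $\mathbb{N}$, and let $\varphi$ be a finite Orlicz function. Consider the following properties (for $L_\varphi$ in the non-atomic case, for $\ell_\varphi$ in the case of the counting measure). (i) $L_\varphi$ or $\ell_\varphi$ has the local diameter two property. (ii) $L_\varphi$ or $\ell_\varphi$ has the diameter two property. (iii) $L_\varphi$ or $\ell_\varphi$ has the strong diameter two property. (iv) $\varphi$ does not satisfy the appropriate $\Delta_2$ condition. Then (iii) $\Rightarrow$ (ii) $\Rightarrow$ (i). For the sequence space $\ell_\varphi$ all properties (i)-(iv) are equivalent. If in addition $\varphi$ is an $N$-function at infinity, then (i)-(iv) are also all equivalent for the function space $L_\varphi$.
   Context: All spaces are real; $(\Omega,\Sigma,\mu)$ is a complete $\sigma$-finite measure space with $\mu(\Omega)>0$. An Orlicz function is a convex, left-continuous function $\varphi:[0,\infty)\to[0,\infty]$ with $\varphi(0)=0$, not identically zero and not identically infinite on $(0,\infty)$; it is finite if it does not take the value $\infty$. It is an $N$-function at infinity if $\lim_{u\to\infty}\varphi(u)/u=\infty$. The appropriate $\Delta_2$ condition: for non-atomic $\mu$ with $\mu(\Omega)=\infty$ it is $\Delta_2$: there is $K>2$ with $\varphi(2u)\le K\varphi(u)$ for all $u\ge0$; for non-atomic $\mu$ with $\mu(\Omega)<\infty$ it is $\Delta_2^\infty$: there are $K>2$, $u_0\ge0$ with $\varphi(u_0)<\infty$ and $\varphi(2u)\le K\varphi(u)$ for all $u\ge u_0$; for counting measure on $\mathbb{N}$ it is $\Delta_2^0$: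 there are $K>2$ and $u_0$ with $0<\varphi(u_0)<\infty$ and $\varphi(2u)\le K\varphi(u)$ for all $0\le u\le u_0$. For measurable $f:\Omega\to\mathbb{R}$ (modulo a.e. equality) let $I_\varphi(f)=\int_\Omega\varphi(|f|)\,d\mu$. The Orlicz space is the set of $f$ with $I_\varphi(\lambda f)<\infty$ for some $\lambda>0$, with the Luxemburg norm $\|f\|_\varphi=\inf\{\epsilon>0:I_\varphi(f/\epsilon)\le1\}$; it is denoted $L_\varphi$ when $\mu$ is non-atomic and $\ell_\varphi$ when $\Omega=\mathbb{N}$ with counting measure. A slice of the closed unit ball $B_X$ of a Banach space $X$ is a set $\{x\in B_X:x^*(x)>1-\epsilon\}$ with $x^*\in S_{X^*}$, $\epsilon>0$. $X$ has the local diameter two property if every slice of $B_X$ has diameter two; the diameter two property if every nonempty relatively weakly open subset of $B_X$ has diameter two; the strong diameter two property if every finite convex combination of slices of $B_X$ has diameter two. *)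

(* Defs.v *)
From HB Require Import structures.
From mathcomp Require Import all_boot all_order all_algebra ring_quotient.
From mathcomp Require Import all_classical all_reals all_analysis.
From mathcomp Require Import measurable_realfun ring lra.

Set Implicit Arguments.
Unset Strict Implicit.
Unset Printing Implicit Defensive.

Import Order.TTheory GRing.Theory Num.Theory.
Import numFieldNormedType.Exports.

Local Open Scope classical_set_scope.
Local Open Scope ring_scope.

Section diameter_two.
Context {R : realType}.

Definition diam {V : normedModType R} (A : set V) : \bar R :=
  ereal_sup [set (`|p.1 - p.2|)%:E | p in A `*` A].

Definition unit_ball {V : normedModType R} : set V := [set x | `|x| <= 1].

Record dual (V : normedModType R) := Dual {
  dual_fun :> {linear V -> R^o};
  dual_continuous : continuous dual_fun }.

Definition dual_norm {V : normedModType R} (f : dual V) : R :=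
  sup [set `|f x| | x in @unit_ball V].

Definition slice {V : normedModType R} (f : dual V) (e : R) : set V :=
  unit_ball `&` [set x | 1 - e < f x].

Definition is_slice {V : normedModType R} (S : set V) : Prop :=
  exists f : dual V, exists e : R, [/\ dual_norm f = 1, 0 < e & S = slice f e].

Definition weak_topology (V : normedModType R) : topologicalType :=
  sup_topology (fun f : dual V =>
    Topological.class (initial_topology (f : V -> R^o))).

Definition weakly_open {V : normedModType R} (W : set V) : Prop :=
  @open (weak_topology V) W.

Definition convex_combination {V : normedModType R} n (w : 'I_n -> R)
    (S : 'I_n -> set V) : set V :=
  [set x | exists2 y : 'I_n -> V,
     forall i, S i (y i) & x = \sum_(i < n) w i *: y i].

Definition LD2P (V : normedModType R) : Prop :=
  forall S : set V, is_slice S -> diam S = 2%:E.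

Definition D2P (V : normedModType R) : Prop :=
  forall W : set V, weakly_open W -> W `&` unit_ball !=set0 ->
    diam (W `&` unit_ball) = 2%:E.

Definition SD2P (V : normedModType R) : Prop :=
  forall n (w : 'I_n -> R) (S : 'I_n -> set V),
    (forall i, 0 <= w i) -> \sum_(i < n) w i = 1 ->
    (forall i, is_slice (S i)) -> diam (convex_combination w S) = 2%:E.

End diameter_two.

Section atoms.
Context d (T : measurableType d) (R : realType).
Variable mu : {measure set T -> \bar R}.

Definition atom (A : set T) : Prop :=
  [/\ measurable A, (0 < mu A)%E & forall B, measurable B -> B `<=` A ->
    mu B = 0%E \/ mu (A `\` B) = 0%E].

Definition nonatomic : Prop := forall A, ~ atom A.

End atoms.

Section orlicz_functions.
Context {R : realType}.

(* Only the values on [0, +oo[ are relevant. *)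
Record orliczFunction := OrliczFunction {
  orlicz_fun :> R -> \bar R;
  orlicz_ge0 : forall u : R, 0 <= u -> (0 <= orlicz_fun u)%E;
  orlicz0 : orlicz_fun 0 = 0%E;
  orlicz_convex : forall t u v : R, 0 <= t <= 1 -> 0 <= u -> 0 <= v ->
    (orlicz_fun (t * u + (1 - t) * v)%R <=
     t%:E * orlicz_fun u + (1 - t)%:E * orlicz_fun v)%E;
  orlicz_left_continuous : forall u : R, 0 < u ->
    orlicz_fun x @[x --> u^'-] --> orlicz_fun u;
  orlicz_neq0 : exists2 u : R, 0 < u & orlicz_fun u <> 0%E;
  orlicz_neqy : exists2 u : R, 0 < u & orlicz_fun u <> +oo%E }.

Implicit Type phi : orliczFunction.

Definition finite_orlicz phi : Prop :=
  forall u : R, 0 <= u -> (phi u < +oo)%E.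

Definition N_function_at_infinity phi : Prop :=
  (phi u * (u^-1)%:E)%E @[u --> +oo] --> +oo%E.

Definition Delta2 phi : Prop :=
  exists2 K : R, 2 < K &
    forall u : R, 0 <= u -> (phi (2 * u)%R <= K%:E * phi u)%E.

Definition Delta2_infty phi : Prop :=
  exists K u0 : R, [/\ 2 < K, 0 <= u0, (phi u0 < +oo)%E &
    forall u : R, u0 <= u -> (phi (2 * u)%R <= K%:E * phi u)%E].

Definition Delta2_zero phi : Prop :=
  exists K u0 : R, [/\ 2 < K, 0 <= u0, (0 < phi u0 < +oo)%E &
    forall u : R, 0 <= u <= u0 -> (phi (2 * u)%R <= K%:E * phi u)%E].

Definition Delta2_nonatomic phi d (T : measurableType d)
    (mu : {measure set T -> \bar R}) : Prop :=
  if mu [set: T] == +oo%E then Delta2 phi else Delta2_infty phi.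

Lemma orlicz_scale_le phi t u : 0 <= t <= 1 -> 0 <= u ->
  (phi (t * u)%R <= t%:E * phi u)%E.
Proof.
move=> t01 u0; have := orlicz_convex phi t01 u0 (lexx 0).
by rewrite mulr0 addr0 orlicz0 mule0 adde0.
Qed.

Lemma orlicz_le phi u v : 0 <= u -> u <= v -> (phi u <= phi v)%E.
Proof.
move=> u0 uv; have [v0|v0] := eqVneq v 0.
  by have -> : u = v by apply/eqP; rewrite eq_le uv v0 u0.
have vp : 0 < v by rewrite lt_neqAle eq_sym v0 (le_trans u0 uv).
have t01 : 0 <= u / v <= 1.
  by rewrite divr_ge0 ?(ltW vp)//= ler_pdivrMr// mul1r.
have := orlicz_scale_le phi t01 (ltW vp); rewrite divfK// => /le_trans; apply.
have := orlicz_ge0 phi (ltW vp); case/andP: t01 => t0 t1.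
by move=> p0; rewrite -[leRHS]mul1e lee_wpmul2r// lee_fin.
Qed.

Lemma measurable_orlicz_norm phi :
  measurable_fun [set: R] (fun x : R => phi `|x|).
Proof.
apply: measurability => //=.
  exact/ErealGenOInfty.measurableE.
move=> _ [_ [y ->] <-]; rewrite setTI.
pose I := [set x : R | 0 <= x /\ (y%:E < phi x)%E].
rewrite (_ : _ @^-1` _ = @Num.norm _ R @^-1` I); last first.
  apply/seteqP; split => x /=; rewrite in_itv/= andbT => h; last by case: h.
  by split.
rewrite -[X in measurable X]setTI; apply: (@normr_measurable R setT) => //.
apply: is_interval_measurable => s t /= [s0 ys] [t0 yt] x /andP[sx xt].
split; first exact: le_trans s0 sx.
exact: lt_le_trans ys (orlicz_le _ s0 sx).
Qed.

End orlicz_functions.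
Arguments orliczFunction : clear implicits.

Section modular.
Context d (T : measurableType d) (R : realType).
Variables (mu : {measure set T -> \bar R}) (phi : orliczFunction R).

Definition modular (f : T -> R) : \bar R := (\int[mu]_x phi `|f x|%R)%E.

Definition luxemburg_norm (f : T -> R) : R :=
  inf [set e | 0 < e /\ (modular (fun x => f x / e)%R <= 1)%E].

Lemma measurable_modular (f : T -> R) : measurable_fun setT f ->
  measurable_fun setT (fun x => phi `|f x|).
Proof. exact: (measurableT_comp (measurable_orlicz_norm phi)). Qed.

Lemma modular_ge0 f : (0 <= modular f)%E.
Proof. by apply: integral_ge0 => x _; exact: orlicz_ge0. Qed.

Lemma modular0 : modular (fun=> 0) = 0%E.
Proof. by apply: integral0_eq => x _; rewrite normr0 orlicz0. Qed.

Lemma modular_norm (f g : T -> R) : (forall x, `|f x| = `|g x|) ->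
  modular f = modular g.
Proof. by move=> fg; apply: eq_integral => x _; rewrite fg. Qed.

Lemma modular_le (f g : T -> R) : measurable_fun setT f ->
  measurable_fun setT g -> (forall x, `|f x| <= `|g x|) ->
  (modular f <= modular g)%E.
Proof.
move=> mf mg fg; apply: ge0_le_integral => //.
- by move=> x _; exact: orlicz_ge0.
- exact: measurable_modular.
- exact: measurable_modular.
- by move=> x _; exact: orlicz_le.
Qed.

Lemma modular_convex (f g : T -> R) t : measurable_fun setT f ->
  measurable_fun setT g -> 0 <= t <= 1 ->
  (modular (fun x => t * f x + (1 - t) * g x)%R <=
   t%:E * modular f + (1 - t)%:E * modular g)%E.
Proof.
move=> mf mg /[dup] t01 /andP[t0 t1].
have t'0 : 0 <= 1 - t by rewrite subr_ge0.
rewrite /modular -ge0_integralZl_EFin//; last 2 first.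
- by move=> x _; exact: orlicz_ge0.
- exact: measurable_modular.
rewrite -ge0_integralZl_EFin//; last 2 first.
- by move=> x _; exact: orlicz_ge0.
- exact: measurable_modular.
rewrite -ge0_integralD//; last 4 first.
- by move=> x _; rewrite mule_ge0// orlicz_ge0.
- by apply: measurable_funeM; exact: measurable_modular.
- by move=> x _; rewrite mule_ge0// orlicz_ge0.
- by apply: measurable_funeM; exact: measurable_modular.
apply: ge0_le_integral => //.
- by move=> x _; exact: orlicz_ge0.
- apply: measurable_modular.
  by apply: measurable_funD; apply: measurable_funM => //; exact: measurable_cst.
- by apply: emeasurable_funD; apply: measurable_funeM; exact: measurable_modular.
- move=> x _; apply: le_trans (orlicz_convex phi t01 (normr_ge0 _) (normr_ge0 _)).
  apply: orlicz_le => //; apply: le_trans (ler_normD _ _) _.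
  by rewrite !normrM (ger0_norm t0) (ger0_norm t'0).
Qed.

Lemma modular_scale (f : T -> R) t : measurable_fun setT f -> 0 <= t <= 1 ->
  (modular (fun x => t * f x)%R <= t%:E * modular f)%E.
Proof.
move=> mf t01.
have m0 : measurable_fun setT (fun _ : T => (0 : R)) by exact: measurable_cst.
have := modular_convex mf m0 t01.
rewrite modular0 mule0 adde0; apply: le_trans; rewrite le_eqVlt; apply/orP; left.
by apply/eqP/modular_norm => x; rewrite mulr0 addr0.
Qed.

Lemma ae_eq_modular (f g : T -> R) : measurable_fun setT f ->
  measurable_fun setT g -> f = g %[ae mu] -> modular f = modular g.
Proof.
move=> mf mg fg; apply: ge0_ae_eq_integral => //.
- exact: measurable_modular.
- exact: measurable_modular.
- by move=> x _; exact: orlicz_ge0.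
- by move=> x _; exact: orlicz_ge0.
- by apply: filterS fg => x /= h /h ->.
Qed.

Lemma ae_eq_luxemburg (f g : T -> R) : measurable_fun setT f ->
  measurable_fun setT g -> f = g %[ae mu] ->
  luxemburg_norm f = luxemburg_norm g.
Proof.
move=> mf mg fg; rewrite /luxemburg_norm; congr inf.
apply/seteqP; split => e /= [e0 he]; split => //.
  rewrite (_ : modular _ = modular (fun x => f x / e)) //.
  apply: ae_eq_modular.
  - exact: measurable_funM.
  - exact: measurable_funM.
  - by apply: filterS fg => x /= h /h ->.
rewrite (_ : modular _ = modular (fun x => g x / e)) //.
apply: ae_eq_modular.
- exact: measurable_funM.
- exact: measurable_funM.
- by apply: filterS fg => x /= h /h ->.
Qed.

Definition finite_modular (f : T -> R) : Prop :=
  exists2 l : R, 0 < l & (modular (fun x => l * f x)%R < +oo)%E.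

Lemma finite_modularD (f g : T -> R) : measurable_fun setT f ->
  measurable_fun setT g -> finite_modular f -> finite_modular g ->
  finite_modular (fun x => f x + g x).
Proof.
move=> mf mg [a a0 ha] [b b0 hb].
pose c := Num.min a b; have c0 : 0 < c by rewrite lt_min a0.
have h2 : 0 <= (2^-1 : R) <= 1 by rewrite invr_ge0 ler0n invf_le1 ?ler1n.
exists (2^-1 * c); first by rewrite mulr_gt0 ?invr_gt0.
have H h l : measurable_fun setT h -> c <= l ->
    (modular (fun x => c * h x)%R <= modular (fun x => l * h x)%R)%E.
  move=> mh cl; apply: modular_le; do ?exact: measurable_funM.
  move=> x; rewrite !normrM ler_wpM2r// !gtr0_norm//.
  exact: lt_le_trans c0 cl.
have mc h : measurable_fun setT h -> measurable_fun setT (fun x : T => c * h x).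
  by move=> mh; exact: measurable_funM.
rewrite (@modular_norm _ (fun x => 2^-1 * (c * f x) + (1 - 2^-1) * (c * g x))).
  apply: le_lt_trans (modular_convex (mc _ mf) (mc _ mg) h2) _.
  have [h0 h1] := andP h2; apply: lte_add_pinfty.
    rewrite lte_mul_pinfty ?lee_fin//; apply: le_lt_trans ha.
    by apply: H => //; rewrite ge_min lexx.
  rewrite lte_mul_pinfty ?lee_fin ?subr_ge0//; apply: le_lt_trans hb.
  by apply: H => //; rewrite ge_min lexx orbT.
by move=> x; congr `|_|; field.
Qed.

Lemma finite_modularZ (f : T -> R) a : finite_modular f ->
  finite_modular (fun x => a * f x).
Proof.
move=> [l l0 hl]; have [->|a0] := eqVneq a 0.
  exists 1 => //; rewrite (@modular_norm _ (fun=> 0)) ?modular0// => x.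
  by rewrite mul0r mulr0.
exists (l / `|a|); first by rewrite divr_gt0 ?normr_gt0.
rewrite (@modular_norm _ (fun x => l * f x)) // => x.
by rewrite !normrM normfV normr_id mulrA divfK ?normr_eq0.
Qed.

Lemma finite_modular_scale (f : T -> R) : measurable_fun setT f ->
  finite_modular f -> exists e, 0 < e /\ (modular (fun x => f x / e)%R <= 1)%E.
Proof.
move=> mf [l l0 hl]; pose M := fine (modular (fun x => l * f x)).
have ME : modular (fun x => l * f x) = M%:E.
  by rewrite fineK// ge0_fin_numE// modular_ge0.
have M0 : 0 <= M by rewrite -lee_fin -ME modular_ge0.
have M1 : 0 < 1 + M by rewrite (lt_le_trans ltr01)// lerDl.
exists ((1 + M) / l); split; first by rewrite divr_gt0.
have h : 0 <= (1 + M)^-1 <= 1.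
  by rewrite invr_ge0 (ltW M1) invf_le1// lerDl.
rewrite (@modular_norm _ (fun x => (1 + M)^-1 * (l * f x))).
  have mlf : measurable_fun setT (fun x => l * f x) by exact: measurable_funM.
  apply: le_trans (modular_scale mlf h) _.
  by rewrite ME -EFinM lee_fin mulrC ler_pdivrMr// mul1r lerDr.
by move=> x; congr `|_|; field; rewrite !lt0r_neq0.
Qed.

Lemma luxemburg_ge0 (f : T -> R) : 0 <= luxemburg_norm f.
Proof.
rewrite /luxemburg_norm; set E := [set _ | _].
have [E0|/set0P ne] := eqVneq E set0; first by rewrite E0 inf0.
by apply: lb_le_inf => // e [/ltW].
Qed.

Lemma luxemburg_le (f : T -> R) e : 0 < e ->
  (modular (fun x => f x / e)%R <= 1)%E -> luxemburg_norm f <= e.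
Proof. by move=> e0 he; apply: ge_inf => //; exists 0 => r [/ltW]. Qed.

Lemma luxemburg_lt (f : T -> R) e : measurable_fun setT f ->
  finite_modular f -> luxemburg_norm f < e ->
  (modular (fun x => f x / e)%R <= 1)%E.
Proof.
move=> mf hf fe; have [c [c0 hc] ce] := inf_lt (finite_modular_scale mf hf) fe.
apply: le_trans hc; apply: modular_le; do ?exact: measurable_funM.
have e0 := lt_trans c0 ce; move=> x.
rewrite !normrM ler_wpM2l// !gtr0_norm ?invr_gt0//.
by rewrite lef_pV2 ?posrE// ltW.
Qed.

Lemma luxemburgD (f g : T -> R) : measurable_fun setT f ->
  measurable_fun setT g -> finite_modular f -> finite_modular g ->
  luxemburg_norm (fun x => f x + g x) <= luxemburg_norm f + luxemburg_norm g.
Proof.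
move=> mf mg hf hg; apply/ler_addgt0Pr => e e0.
pose a := luxemburg_norm f + e / 2; pose b := luxemburg_norm g + e / 2.
have e2 : 0 < e / 2 by rewrite divr_gt0.
have a0 : 0 < a by rewrite ltr_wpDl// luxemburg_ge0.
have b0 : 0 < b by rewrite ltr_wpDl// luxemburg_ge0.
have ab0 : 0 < a + b by rewrite addr_gt0.
have -> : luxemburg_norm f + luxemburg_norm g + e = a + b.
  by rewrite /a /b addrACA -splitr.
apply: luxemburg_le => //.
have t01 : 0 <= a / (a + b) <= 1.
  by rewrite divr_ge0 ?(ltW a0) ?(ltW ab0)//= ler_pdivrMr// mul1r lerDl ltW.
rewrite (@modular_norm _ (fun x => a / (a + b) * (f x / a) +
    (1 - a / (a + b)) * (g x / b))); last first.
  by move=> x; congr `|_|; field; rewrite !gt_eqF.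
have mfa : measurable_fun setT (fun x => f x / a) by exact: measurable_funM.
have mgb : measurable_fun setT (fun x => g x / b) by exact: measurable_funM.
apply: le_trans (modular_convex mfa mgb t01) _.
have [t0 t1] := andP t01; have t'0 : 0 <= 1 - a / (a + b) by rewrite subr_ge0.
have -> : (1 = (a / (a + b))%:E * 1 + (1 - a / (a + b))%:E * 1 :> \bar R)%E.
  by rewrite !mule1 -EFinD subrKC.
apply: leeD; apply: lee_wpmul2l; rewrite ?lee_fin//.
- by apply: luxemburg_lt => //; rewrite ltrDl.
- by apply: luxemburg_lt => //; rewrite ltrDl.
Qed.

Let luxemburgZ_le (f : T -> R) a : measurable_fun setT f ->
  finite_modular f ->
  luxemburg_norm (fun x => a * f x) <= `|a| * luxemburg_norm f.
Proof.
move=> mf hf; apply/ler_addgt0Pr => e e0.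
pose b := `|a| + 1; have b0 : 0 < b by rewrite ltr_wpDl.
pose c := luxemburg_norm f + e / b.
have c0 : 0 < c by rewrite ltr_wpDl ?luxemburg_ge0// divr_gt0.
apply: (@le_trans _ _ (`|a| * luxemburg_norm f + e)) => //.
have [->|a0] := eqVneq a 0.
  rewrite normr0 mul0r add0r; apply: luxemburg_le => //.
  rewrite (@modular_norm _ (fun=> 0)) ?modular0// => x.
  by rewrite !mul0r.
have na0 : 0 < `|a| by rewrite normr_gt0.
apply: (@le_trans _ _ (`|a| * c)).
  apply: luxemburg_le; first by rewrite mulr_gt0.
  rewrite (@modular_norm _ (fun x => f x / c)).
    by apply: luxemburg_lt => //; rewrite ltrDl divr_gt0.
  move=> x; rewrite !normrM invfM !normrM !normfV normr_id.
  by field; rewrite !gt_eqF// normr_gt0 gt_eqF.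
rewrite /c mulrDr lerD2l mulrA ler_pdivrMr// mulrC ler_wpM2l ?(ltW e0)//.
by rewrite /b lerDl.
Qed.

Lemma luxemburgZ (f : T -> R) a : measurable_fun setT f ->
  finite_modular f ->
  luxemburg_norm (fun x => a * f x) = `|a| * luxemburg_norm f.
Proof.
move=> mf hf; apply/eqP; rewrite eq_le luxemburgZ_le//=.
have [->|a0] := eqVneq a 0; first by rewrite normr0 mul0r luxemburg_ge0.
have maf : measurable_fun setT (fun x => a * f x) by exact: measurable_funM.
have := luxemburgZ_le a^-1 maf (finite_modularZ a hf).
rewrite (_ : (fun x => a^-1 * (a * f x)) = f); last first.
  by apply/funext => x; rewrite mulKf.
by rewrite normfV ler_pdivlMl// normr_gt0.
Qed.

Lemma luxemburg_eq0 (f : T -> R) : measurable_fun setT f ->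
  finite_modular f -> luxemburg_norm f = 0 -> f = (fun=> 0) %[ae mu].
Proof.
move=> mf hf f0.
have mc c : measurable_fun setT (fun x => c * f x) by exact: measurable_funM.
have H1 c : 0 < c -> (modular (fun x => c * f x)%R <= 1)%E.
  move=> c0; rewrite (@modular_norm _ (fun x => f x / c^-1)).
    by apply: luxemburg_lt => //; rewrite f0 invr_gt0.
  by move=> x; rewrite invrK mulrC.
have H2 c : 0 < c -> modular (fun x => c * f x) = 0%E.
  move=> c0; apply/eqP; rewrite eq_le modular_ge0 andbT.
  apply/lee_addgt0Pr => e e0; rewrite add0e.
  wlog e1 : e e0 / e <= 1.
    move=> h; have [/h|/ltW e1] := leP e 1; first exact.
    by apply: le_trans (h 1 _ _) _ => //; rewrite lee_fin.
  rewrite (@modular_norm _ (fun x => e * (c / e * f x))).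
    have e01 : 0 <= e <= 1 by rewrite (ltW e0).
    apply: le_trans (modular_scale (mc _) e01) _.
    rewrite -[leRHS]mule1; apply: lee_wpmul2l; first by rewrite lee_fin ltW.
    by apply: H1; rewrite divr_gt0.
  by move=> x; congr `|_|; field; rewrite gt_eqF.
have [u u0 pu] := orlicz_neq0 phi.
have H3 (n : nat) : \forall x \ae mu, phi `|n.+1%:R * f x| = 0%E.
  have /ae_eq_integral_abs : measurable_fun setT (fun x => phi `|n.+1%:R * f x|).
    exact: measurable_modular.
  move=> /(_ mu measurableT)[+ _].
  have -> : (\int[mu]_x `|phi `|n.+1%:R * f x|%R| = 0)%E.
    rewrite -[RHS](H2 n.+1%:R)//; apply: eq_integral => x _.
    by rewrite gee0_abs// orlicz_ge0.
  by move=> /(_ erefl); apply: filterS => x /= /(_ I).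
have := ae_foralln H3; apply: filterS => x /= h _; apply/eqP.
apply/negPn/negP => fx0; have nfx : 0 < `|f x| by rewrite normr_gt0.
have [n un] : exists n, u <= n.+1%:R * `|f x|.
  exists (Num.truncn (u / `|f x|)); rewrite -ler_pdivrMr//.
  by apply/ltW/truncnS_gt.
apply: pu; apply/eqP; rewrite eq_le orlicz_ge0 ?(ltW u0)// andbT -(h n).
by apply: orlicz_le; [exact: ltW|rewrite normrM normr_nat].
Qed.

End modular.

Section orlicz_space.
Context d (T : measurableType d) (R : realType).
Variables (mu : {measure set T -> \bar R}) (phi : orliczFunction R).

Definition orlicz_class : {pred {mfun T >-> R}} :=
  mem [set f : {mfun T >-> R} | finite_modular mu phi f].

Lemma orlicz_class_submod_closed : submod_closed orlicz_class.
Proof.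
split.
  rewrite inE; exists 1 => //=.
  by under [X in modular _ _ X]eq_fun do rewrite mulr0; rewrite modular0.
move=> a f g; rewrite !inE => hf hg.
apply: (@finite_modularD _ _ _ _ _ (a *: (f : T -> R)) g) => //.
- exact: measurable_funM.
- exact: finite_modularZ.
Qed.

HB.instance Definition _ :=
  GRing.isSubmodClosed.Build R {mfun T >-> R} orlicz_class
    orlicz_class_submod_closed.

Record orliczFun := OrliczFun {
  orlicz_mfun :> {mfun T >-> R};
  orlicz_mfunP : orlicz_mfun \in orlicz_class }.

HB.instance Definition _ := [isSub for orlicz_mfun].
HB.instance Definition _ := [Choice of orliczFun by <:].
HB.instance Definition _ := [SubChoice_isSubLmodule of orliczFun by <:].

Lemma orliczFun_measurable (f : orliczFun) : measurable_fun setT f.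
Proof. exact: measurable_funPT. Qed.

Lemma orliczFun_finite (f : orliczFun) : finite_modular mu phi f.
Proof. by have := orlicz_mfunP f; rewrite inE. Qed.

Definition ae_null : {pred orliczFun} :=
  mem [set f : orliczFun | (f : T -> R) = (fun=> 0) %[ae mu]].

Lemma ae_null_submod_closed : submod_closed ae_null.
Proof.
split; first by rewrite inE; exact: ae_eq_refl.
move=> a f g; rewrite !inE /= => f0 g0; apply: filterS2 f0 g0 => x /= f0 g0 _.
change (a * f x + g x = 0).
by rewrite f0// g0// mulr0 addr0.
Qed.

HB.instance Definition _ :=
  GRing.isSubmodClosed.Build R orliczFun ae_null ae_null_submod_closed.

End orlicz_space.

Section orlicz_quotient.
Context d (T : measurableType d) (R : realType).
Variables (mu : {measure set T -> \bar R}) (phi : orliczFunction R).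
Local Open Scope quotient_scope.

(* Orlicz functions modulo equality mu-a.e. *)
Definition orliczSpace : Type := Quotient.quot (@ae_null d T R mu phi).
HB.instance Definition _ := GRing.Zmodule.on orliczSpace.
HB.instance Definition _ := EqQuotient.on orliczSpace.

Lemma orlicz_pi_eqP (f g : orliczFun mu phi) :
  \pi_orliczSpace f = \pi_orliczSpace g <-> (f : T -> R) = g %[ae mu].
Proof.
split => [/eqP|fg].
  rewrite -[_ == _]Quotient.idealrBE inE /=; apply: filterS => x /= + _.
  by move=> /(_ I)/eqP; rewrite subr_eq0 => /eqP.
apply/eqP; rewrite -[_ == _]Quotient.idealrBE inE /=; apply: filterS fg.
by move=> x /= + _ => /(_ I) fg; apply/eqP; rewrite subr_eq0; apply/eqP.
Qed.

Lemma orlicz_repr_pi (f : orliczFun mu phi) :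
  (repr (\pi_orliczSpace f) : T -> R) = f %[ae mu].
Proof. by apply/orlicz_pi_eqP; rewrite reprK. Qed.

Definition orlicz_scale (a : R) (x : orliczSpace) : orliczSpace :=
  \pi_orliczSpace (a *: repr x).

Lemma orlicz_pi_scale a (f : orliczFun mu phi) :
  orlicz_scale a (\pi_orliczSpace f) = \pi_orliczSpace (a *: f).
Proof.
apply/orlicz_pi_eqP; apply: filterS (orlicz_repr_pi f) => x /= + _.
move=> /(_ I) fE.
change (a * (repr (\pi_orliczSpace f) : orliczFun mu phi) x = a * f x).
by rewrite fE.
Qed.

Lemma orlicz_pi_add (f g : orliczFun mu phi) :
  \pi_orliczSpace f + \pi_orliczSpace g = \pi_orliczSpace (f + g).
Proof. by rewrite [RHS]Quotient.pi_add. Qed.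

Fact orlicz_scaleA a b x :
  orlicz_scale a (orlicz_scale b x) = orlicz_scale (a * b) x.
Proof.
elim/quotW: x => f; rewrite (orlicz_pi_scale b f) (orlicz_pi_scale a (b *: f)).
by rewrite (orlicz_pi_scale (a * b) f) scalerA.
Qed.

Fact orlicz_scale1 : left_id 1 orlicz_scale.
Proof. by elim/quotW => f; rewrite (orlicz_pi_scale 1 f) scale1r. Qed.

Fact orlicz_scaleDr : right_distributive orlicz_scale +%R.
Proof.
move=> a; elim/quotW => f; elim/quotW => g.
rewrite (orlicz_pi_scale a f) (orlicz_pi_scale a g) !orlicz_pi_add.
by rewrite (orlicz_pi_scale a (f + g)) scalerDr.
Qed.

Fact orlicz_scaleDl x : {morph orlicz_scale^~ x : a b / a + b}.
Proof.
elim/quotW: x => f a b.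
rewrite (orlicz_pi_scale a f) (orlicz_pi_scale b f) orlicz_pi_add.
by rewrite (orlicz_pi_scale (a + b) f) scalerDl.
Qed.

HB.instance Definition _ := GRing.Zmodule_isLmodule.Build R orliczSpace
  orlicz_scaleA orlicz_scale1 orlicz_scaleDr orlicz_scaleDl.

Definition orlicz_norm (x : orliczSpace) : R := luxemburg_norm mu phi (repr x).

Lemma orlicz_norm_pi (f : orliczFun mu phi) :
  orlicz_norm (\pi_orliczSpace f) = luxemburg_norm mu phi f.
Proof.
apply: ae_eq_luxemburg; [exact: orliczFun_measurable..|exact: orlicz_repr_pi].
Qed.

Fact orlicz_normD (x y : orliczSpace) :
  orlicz_norm (x + y) <= orlicz_norm x + orlicz_norm y.
Proof.
elim/quotW: x => f; elim/quotW: y => g; rewrite orlicz_pi_add !orlicz_norm_pi.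
exact: (luxemburgD (orliczFun_measurable f) (orliczFun_measurable g)
  (orliczFun_finite f) (orliczFun_finite g)).
Qed.

Fact orlicz_normZ (a : R) (x : orliczSpace) :
  orlicz_norm (a *: x) = `|a| * orlicz_norm x.
Proof.
elim/quotW: x => f; rewrite [_ *: _](orlicz_pi_scale a f) !orlicz_norm_pi.
exact: (luxemburgZ a (orliczFun_measurable f) (orliczFun_finite f)).
Qed.

Fact orlicz_norm_eq0 (x : orliczSpace) : orlicz_norm x = 0 -> x = 0.
Proof.
elim/quotW: x => f; rewrite orlicz_norm_pi => f0.
rewrite -[RHS](@pi_zeror _ _ _ _ _ (Quotient.quot (@ae_null d T R mu phi))).
apply/orlicz_pi_eqP; 
exact: (luxemburg_eq0 (orliczFun_measurable f) (orliczFun_finite f) f0).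
Qed.

HB.instance Definition _ := Lmodule_isNormed.Build R orliczSpace
  orlicz_normD orlicz_normZ orlicz_norm_eq0.

Lemma orlicz_normE (x : orliczSpace) : `|x| = luxemburg_norm mu phi (repr x).
Proof. by []. Qed.

End orlicz_quotient.
Arguments orliczSpace {d T R} mu phi.

(* Main.v *)
(* If the Delta_2 condition fails, there are arbitrarily many disjoint sets A_j and
   functions h_j = u 1_(A_j) of tiny total modular and norm close to 1. Given slices
   S_i, points x_i in S_i and functionals f_i, the sums over j of |f_i h_j| and of
   |f_i (x_i 1_(A_j))| are at most 1, so for some j they are all small; then
   x_i 1_(~A_j) + h_j and x_i 1_(~A_j) - h_j lie in S_i for every i, and the convex
   combination of the slices has diameter two.

   Conversely, suppose Delta_2 holds and let u be a point where phi has a supporting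
   line of slope p > 0, and phi(u) mu(A) = 1. On the slice of the ball where the integral
   of x over A is almost maximal, the gap between phi(|x|) and the line integrates to
   almost 0 over A and x has small modular off A. If u is an exposed point (on N a single
   atom A makes this unnecessary), x is close to u on A, so that this slice has diameter
   less than two. Superlinearity of phi provides exposed points arbitrarily far out.

   That the strong property implies the diameter two property is Bourgain's lemma: every
   nonempty relatively weakly open subset of the ball B contains a convex combination of
   slices. Here it is proved with approximate farthest points of the image of B under
   finitely many functionals. *)

Require Import Defs.
From HB Require Import structures.
From mathcomp Require Import all_boot all_order all_algebra finmap.
From mathcomp Require Import all_classical all_reals all_analysis.
From mathcomp Require Import measurable_realfun ring lra.

Set Implicit Arguments.
Unset Strict Implicit.
Unset Printing Implicit Defensive.

Import Order.TTheory GRing.Theory Num.Theory.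
Import numFieldNormedType.Exports.

Local Open Scope classical_set_scope.
Local Open Scope ring_scope.

(** * Slices and the weak topology *)

Section normed_space.
Context {R : realType} {V : normedModType R}.
Implicit Types (f : dual V) (x y : V).

Lemma dual_norm_bound f : exists M, forall x, `|f x| <= M * `|x|.
Proof.
have /linear_boundedP : bounded_near f (nbhs (0 : V)).
  by apply/continuous_linear_bounded/dual_continuous.
move=> /pinfty_ex_gt0[M M0 fM]; exists M; exact: fM.
Qed.

Lemma dual_norm_has_sup f : has_sup [set `|f x| | x in @unit_ball R V].
Proof.
split; first by exists `|f 0|, 0 => //; rewrite /unit_ball/= normr0.
have [M fM] := dual_norm_bound f; exists `|M| => _ [x x1 <-].
apply: le_trans (fM x) _; apply: le_trans (ler_wpM2r _ (ler_norm M)) _ => //.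
by rewrite ler_piMr.
Qed.

Lemma le_dual_norm f x : `|f x| <= dual_norm f * `|x|.
Proof.
have [->|x0] := eqVneq x 0; first by rewrite linear0 !normr0 mulr0.
have nx : 0 < `|x| by rewrite normr_gt0.
rewrite -ler_pdivrMr// -[X in _ / X]normr_id -normrV ?unitfE ?normr_eq0//.
rewrite -normrM mulrC -[_^-1 * _]/(_^-1 *: f x) -linearZ.
apply: ub_le_sup; first by case: (dual_norm_has_sup f).
exists (`|x|^-1 *: x) => //; rewrite /unit_ball/= normrZ normfV normr_id.
by rewrite mulVf ?lexx ?normr_eq0.
Qed.

Lemma dual_norm_ge0 f : 0 <= dual_norm f.
Proof.
have := le_trans (normr_ge0 _) (ub_le_sup (proj2 (dual_norm_has_sup f)) _).
by apply; exists (0 : V) => //; rewrite /unit_ball/= normr0 ler01.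
Qed.

Lemma unit_ball_dual_le f x : unit_ball x -> f x <= dual_norm f.
Proof.
move=> x1; apply: le_trans (ler_norm _) _; apply: le_trans (le_dual_norm f x) _.
by rewrite ler_piMr ?dual_norm_ge0.
Qed.

Lemma dual_norm_approx f e : 0 < e ->
  exists2 x : V, unit_ball x & dual_norm f - e < f x.
Proof.
move=> e0; have [_ [x x1 <-]] := sup_adherent e0 (dual_norm_has_sup f).
rewrite -/(dual_norm f) => fx; have [f0|f0] := leP 0 (f x).
  by exists x => //; rewrite ger0_norm in fx.
exists (- x); first by rewrite /unit_ball/= normrN.
by move: fx; rewrite linearN/= ltr0_norm.
Qed.

Lemma dual_norm0 f : dual_norm f = 0 -> forall x, f x = 0.
Proof.
by move=> f0 x; have := le_dual_norm f x; rewrite f0 mul0r normr_le0 => /eqP.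
Qed.

Fact dual_lin_is_linear n (c : 'I_n -> R) (g : 'I_n -> dual V) :
  linear (fun x => \sum_(i < n) c i * g i x : R^o).
Proof.
move=> a x y; rewrite scaler_sumr -big_split/=; apply: eq_bigr => i _.
by rewrite linearP/= mulrDr -[a *: g i x]/(a * g i x) -[a *: (c i * _)]/(a * (c i * _)); ring.
Qed.

(** [dual V] carries no vector space structure, so linear combinations of functionals are built by
    hand; a single term gives scalar multiples. *)
Lemma dual_lin_ex n (c : 'I_n -> R) (g : 'I_n -> dual V) :
  exists f : dual V, forall x, f x = \sum_(i < n) c i * g i x.
Proof.
pose L := GRing.isLinear.Build _ _ _ _ _ (dual_lin_is_linear c g).
pose l : {linear V -> R^o} := HB.pack (fun x => \sum_(i < n) c i * g i x : R^o) L.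
have lc : continuous l.
  apply: bounded_linear_continuous; apply/linear_boundedP.
  pose M := \sum_(i < n) `|c i| * dual_norm (g i).
  near=> r; move=> x; rewrite /l/=.
  apply: le_trans (ler_norm_sum _ _ _) _.
  apply: (@le_trans _ _ (M * `|x|)).
    rewrite mulr_suml; apply: ler_sum => i _.
    by rewrite normrM -mulrA ler_wpM2l// le_dual_norm.
  by rewrite ler_wpM2r//; near: r; apply: nbhs_pinfty_ge; exact: num_real.
by exists (Dual lc).
Unshelve. all: by end_near. Qed.

(** Normalising [f] divides the depth [d] by [dual_norm f], so functionals of any nonzero norm may
    be used to cut slices. *)
Lemma slice_of_functional f d : dual_norm f != 0 -> 0 < d ->
  is_slice (unit_ball `&` [set x | dual_norm f - d < f x]).
Proof.
move=> f0 d0; have fp : 0 < dual_norm f by rewrite lt_neqAle eq_sym f0 dual_norm_ge0.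
have [h hE] := dual_lin_ex (fun _ : 'I_1 => (dual_norm f)^-1) (fun=> f).
have {}hE x : h x = (dual_norm f)^-1 * f x by rewrite hE big_ord1.
exists h, (d / dual_norm f); split.
- apply/eqP; rewrite eq_le; apply/andP; split.
    apply: ge_sup; first by case: (dual_norm_has_sup h).
    move=> _ [x x1 <-]; rewrite hE normrM normfV (ger0_norm (ltW fp)).
    have {}x1 : `|f x| <= dual_norm f.
      by apply: le_trans (le_dual_norm f x) _; rewrite ler_piMr ?dual_norm_ge0.
    by rewrite ler_pdivrMl// mulr1.
  apply/ler_addgt0Pl => e e0.
  have [x x1 fx] := dual_norm_approx f (mulr_gt0 e0 fp).
  rewrite -lerBlDl; apply: le_trans (unit_ball_dual_le h x1).
  by rewrite hE ler_pdivlMl// mulrBr mulr1 mulrC; apply: ltW.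
- by rewrite divr_gt0.
- rewrite /slice; congr (_ `&` _); apply/seteqP; split => x /=; rewrite hE.
    by move=> ?; rewrite ltr_pdivlMl// mulrBr mulr1 mulrCA divff// mulr1.
  by rewrite ltr_pdivlMl// mulrBr mulr1 mulrCA divff// mulr1.
Qed.

Lemma slice_neq0 (S : set V) : is_slice S -> S !=set0.
Proof.
move=> [f [e [f1 e0 ->]]]; have [x x1 fx] := dual_norm_approx f e0.
by exists x; split => //=; rewrite -f1.
Qed.

Lemma diam_le2 (A : set V) : A `<=` unit_ball -> (diam A <= 2%:E)%E.
Proof.
move=> A1; apply: ge_ereal_sup => _ [[x y] [/= /A1 x1 /A1 y1] <-].
rewrite lee_fin; apply: le_trans (ler_normB _ _) _.
by rewrite (_ : 2 = 1 + 1)//; apply: lerD.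
Qed.

Lemma diam_subset (A B : set V) : A `<=` B -> (diam A <= diam B)%E.
Proof.
move=> AB; apply: le_ereal_sup => _ [[x y] [/= /AB x1 /AB y1] <-].
by exists (x, y).
Qed.

Lemma le_norm_diam (A : set V) x y : A x -> A y -> (`|x - y|%:E <= diam A)%E.
Proof. by move=> Ax Ay; apply: ereal_sup_ubound; exists (x, y). Qed.

Lemma unit_ball_convex n (w : 'I_n -> R) (y : 'I_n -> V) :
  (forall i, 0 <= w i) -> \sum_(i < n) w i = 1 -> (forall i, unit_ball (y i)) ->
  unit_ball (\sum_(i < n) w i *: y i).
Proof.
move=> w0 w1 y1; rewrite /unit_ball/= -w1.
apply: le_trans (ler_norm_sum _ _ _) _; apply: ler_sum => i _.
by rewrite normrZ ger0_norm// ler_piMr//; exact: y1.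
Qed.

Lemma weakly_open_halfspace f c : weakly_open [set x : V | c < f x].
Proof.
rewrite /weakly_open openE => x /= cx.
have /cvg_sup : nbhs (x : weak_topology V) --> (x : weak_topology V) by apply: cvg_id.
move=> /(_ f); apply.
exists [set x : V | c < f x]; split => //.
by exists [set r : R^o | c < r] => //; exact: open_gt.
Qed.

(** The sets containing a neighbourhood of [x] cut out by finitely many functionals form a filter
    [F]. It converges to [x] in each initial topology, hence in their supremum. *)
Lemma weakly_open_basic (W : set V) x : weakly_open W -> W x ->
  exists n (g : 'I_n -> dual V) (e : R), 0 < e /\
    (forall y, (forall i, `|g i y - g i x| < e) -> W y).
Proof.
move=> oW Wx.
pose F : set_system V := [set A | exists n (g : 'I_n -> dual V) (e : R), 0 < e /\
    (forall y, (forall i, `|g i y - g i x| < e) -> A y)].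
have FF : Filter F.
  split.
  - by exists 0%N, (fun i : 'I_0 => False_rect _ (elimF idP (ltn0 i) (ltn_ord i))), 1.
  - move=> A B [n [g [e [e0 gA]]]] [m [h [d [d0 hB]]]].
    exists (n + m)%N, (fun i : 'I_(n + m) =>
      match fintype.split i with inl j => g j | inr j => h j end).
    exists (Num.min e d); split; first by rewrite lt_min e0.
    move=> y gh; split.
    + apply: gA => i; have := gh (lshift m i).
      by rewrite (unsplitK (inl i)) lt_min => /andP[].
    + apply: hB => i; have := gh (rshift n i).
      by rewrite (unsplitK (inr i)) lt_min => /andP[].
  - move=> A B AB [n [g [e [e0 gA]]]]; exists n, g, e; split => // y /gA; exact: AB.
have : F --> (x : weak_topology V).
  apply/cvg_sup => f A [_ [[B oB <-] Bx BA]].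
  have /nbhs_ballP[e e0 eB] : nbhs (f x) B by apply: open_nbhs_nbhs.
  exists 1%N, (fun=> f), e; split => // y /(_ ord0) fe.
  by apply/BA/eB; rewrite /ball/= distrC.
by apply; apply: open_nbhs_nbhs.
Qed.

Lemma D2P_LD2P : D2P V -> LD2P V.
Proof.
move=> d2 S sS; have [f [e [f1 e0 SE]]] := sS.
have := slice_neq0 sS; rewrite SE /slice setIC => S0.
by apply: d2 => //; exact: weakly_open_halfspace.
Qed.

End normed_space.

(** * Bourgain's lemma *)

Section euclidean.
Context {R : realType} {n : nat}.
Implicit Types u v w : 'rV[R]_n.

Definition dotr u v : R := \sum_(i < n) u ord0 i * v ord0 i.

Lemma dotrC u v : dotr u v = dotr v u.
Proof. by apply: eq_bigr => i _; rewrite mulrC. Qed.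

Lemma dotrDl u v w : dotr (u + v) w = dotr u w + dotr v w.
Proof. by rewrite -big_split; apply: eq_bigr => i _; rewrite mxE mulrDl. Qed.

Lemma dotrZl a u v : dotr (a *: u) v = a * dotr u v.
Proof. by rewrite mulr_sumr; apply: eq_bigr => i _; rewrite mxE mulrA. Qed.

Lemma dotrBl u v w : dotr (u - v) w = dotr u w - dotr v w.
Proof. by rewrite -scaleN1r dotrDl dotrZl mulN1r. Qed.

Lemma dotrDr u v w : dotr u (v + w) = dotr u v + dotr u w.
Proof. by rewrite dotrC dotrDl !(dotrC u). Qed.

Lemma dotrZr a u v : dotr u (a *: v) = a * dotr u v.
Proof. by rewrite dotrC dotrZl dotrC. Qed.

Lemma sqr_le_dotr u i : u ord0 i ^+ 2 <= dotr u u.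
Proof.
rewrite /dotr (bigD1 i)//= -expr2 lerDl; apply: sumr_ge0 => j _.
by rewrite -expr2 sqr_ge0.
Qed.

End euclidean.

Section bourgain.
Context {R : realType} {V : normedModType R} {n : nat} (g : 'I_n -> dual V).

Let F (x : V) : 'rV[R]_n := \row_i g i x.

Let sqdist (u v : 'rV[R]_n) : R := dotr (u - v) (u - v).

Let F_bounded c : exists2 D, 0 < D & forall x, unit_ball x -> sqdist (F x) c < D.
Proof.
exists (1 + \sum_(i < n) (dual_norm (g i) + `|c ord0 i|) ^+ 2).
  by rewrite ltr_pwDl//; apply: sumr_ge0 => i _; rewrite sqr_ge0.
move=> x x1; rewrite ltr_pwDl// /sqdist /dotr; apply: ler_sum => i _.
rewrite !mxE -expr2 -real_normK ?num_real// lerXn2r ?nnegrE//.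
  by rewrite addr_ge0// dual_norm_ge0.
apply: le_trans (ler_normB _ _) _; rewrite lerD2r.
by apply: le_trans (le_dual_norm _ _) _; rewrite ler_piMr ?dual_norm_ge0.
Qed.

Let F_diam : exists2 D, 0 < D &
  forall x y, unit_ball x -> unit_ball y -> sqdist (F x) (F y) < D.
Proof.
exists (1 + \sum_(i < n) (dual_norm (g i) + dual_norm (g i)) ^+ 2).
  by rewrite ltr_pwDl//; apply: sumr_ge0 => i _; rewrite sqr_ge0.
move=> x y x1 y1; rewrite ltr_pwDl// /sqdist /dotr; apply: ler_sum => i _.
rewrite !mxE -expr2 -real_normK ?num_real// lerXn2r ?nnegrE//.
  by rewrite addr_ge0// dual_norm_ge0.
apply: le_trans (ler_normB _ _) _; apply: lerD.
  by apply: le_trans (le_dual_norm _ _) _; rewrite ler_piMr ?dual_norm_ge0.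
by apply: le_trans (le_dual_norm _ _) _; rewrite ler_piMr ?dual_norm_ge0.
Qed.

Variables (i0 : 'I_n) (gi0 : dual_norm (g i0) != 0) (eta : R) (eta0 : 0 < eta).

(** The points of [F(B)] near which some whole slice is mapped. Convex combinations of such points
    come from convex combinations of slices. *)
Let P (p : 'rV[R]_n) : Prop := exists z, [/\ unit_ball z, p = F z &
  exists2 S, is_slice S & forall y, S y -> sqdist (F y) p < eta].

Let sqdist_polar u v c : sqdist u v =
  sqdist u c + sqdist v c - 2 * dotr (u - c) (v - c).
Proof.
rewrite /sqdist; have -> : u - v = (u - c) + (-1) *: (v - c).
  by rewrite scaleN1r opprB addrA subrK.
move: (u - c) (v - c) => a b.
rewrite !(dotrDl, dotrDr, dotrZl, dotrZr) [dotr b a]dotrC; ring.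
Qed.

(* If [F z] is almost the farthest point of [F(B)] from [c], then the slice of
   [B] defined by [x |-> <F x, F z - c>] has an [F]-image close to [F z]. *)
Let farthest c d : 0 < d ->
  exists2 p, P p & forall y, unit_ball y -> sqdist (F y) c <= sqdist p c + d.
Proof.
move=> d0; have [D D0 FD] := F_bounded c.
pose A := [set sqdist (F y) c | y in @unit_ball R V].
have A0 : has_sup A.
  split; first by exists (sqdist (F 0) c), 0 => //; rewrite /unit_ball/= normr0.
  by exists D => _ [y y1 <-]; apply/ltW/FD.
(* With [e] for this minimum, polarisation will bound [sqdist (F y) (F z)] by [3 * e] on the slice,
   which is below [eta]. *)
have dd : 0 < Num.min d (eta / 4) by rewrite lt_min d0 divr_gt0.
have [_ [z z1 <-] zA] := sup_adherent dd A0.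
move: zA dd; set e := Num.min _ _ => zA dd.
have far y : unit_ball y -> sqdist (F y) c < sqdist (F z) c + e.
  move=> y1; rewrite -ltrBlDr; apply: le_lt_trans zA; rewrite lerD2r.
  by apply: ub_le_sup; [case: A0|exists y].
exists (F z); last first.
  move=> y /far/ltW/le_trans; apply; rewrite lerD2l.
  by rewrite /e ge_min lexx.
have [f fE] := dual_lin_ex (fun i => (F z - c) ord0 i) g.
have {}fE x : f x = dotr (F x) (F z - c).
  by rewrite fE; apply: eq_bigr => i _; rewrite mulrC [F x _ _]mxE.
have e4 : e * 4 <= eta by rewrite -ler_pdivlMr// /e ge_min lexx orbT.
have close y : unit_ball y -> f z - e < f y -> sqdist (F y) (F z) < eta.
  move=> y1; rewrite !fE => zy; rewrite (sqdist_polar _ _ c).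
  have := far _ y1; have : dotr (F y - c) (F z - c) > sqdist (F z) c - e.
    have zE : sqdist (F z) c = dotr (F z) (F z - c) - dotr c (F z - c).
      exact: dotrBl.
    by rewrite zE dotrBl; lra.
  move: e4 dd; lra.
exists z; split => //.
(* A zero functional cuts no slice, but then [close] applies on the whole ball and any slice will
   do; [g i0] provides one. *)
have [f0|f0] := eqVneq (dual_norm f) 0.
  exists (unit_ball `&` [set x | dual_norm (g i0) - 1 < g i0 x]).
    exact: slice_of_functional.
  move=> y [y1 _]; apply: close => //.
  by rewrite !(dual_norm0 f0) sub0r oppr_lt0.
exists (unit_ball `&` [set x | dual_norm f - e < f x]).
  exact: slice_of_functional.
move=> y [y1 /= fy]; apply: close => //; apply: le_lt_trans fy.
by rewrite lerD2r; apply: unit_ball_dual_le.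
Qed.

Let hull (q : 'rV[R]_n) : Prop := exists k (w : 'I_k -> R) (p : 'I_k -> 'rV[R]_n),
  [/\ forall j, 0 <= w j, \sum_j w j = 1, forall j, P (p j) & q = \sum_j w j *: p j].

Let hull_point p : P p -> hull p.
Proof.
exists 1%N, (fun=> 1), (fun=> p); split => //; first by rewrite big_ord1.
by rewrite big_ord1 scale1r.
Qed.

Let hull_step q p t : 0 <= t <= 1 -> hull q -> P p -> hull (q + t *: (p - q)).
Proof.
move=> /andP[t0 t1] [k [w [r [w0 w1 Pr ->]]]] Pp.
exists k.+1, (fun i => if unlift ord0 i is Some j then (1 - t) * w j else t),
  (fun i => if unlift ord0 i is Some j then r j else p); split.
- by move=> i; case: unliftP => [j _|//]; rewrite mulr_ge0// subr_ge0.
- rewrite big_ord_recl unlift_none; under eq_bigr do rewrite liftK.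
  by rewrite -mulr_sumr w1 mulr1 subrKC.
- by move=> i; case: unliftP.
- rewrite big_ord_recl unlift_none; under [in RHS]eq_bigr do rewrite liftK -scalerA.
  rewrite -scaler_sumr scalerBl scale1r scalerBr.
  by rewrite addrA addrAC addrA addrC addrA.
Qed.

Let hull_ball q : hull q -> exists2 z, unit_ball z & q = F z.
Proof.
move=> [k [w [p [w0 w1 Pp ->]]]].
have [z zP] := choice Pp.
exists (\sum_(i < k) w i *: z i).
  by apply: unit_ball_convex => // i; case: (zP i).
apply/rowP => i; rewrite !mxE linear_sum summxE; apply: eq_bigr => j _.
by rewrite linearZ mxE; have [_ -> _] := zP j; rewrite mxE.
Qed.

(** Otherwise [F x] has squared distance [m > 0] from the hull. Let [q] be an almost nearest point
    and [a = F x - q]. Moving from [q] towards [p] in [P] cannot bring a real gain, so [p - q] has a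
    small component along [a]. Seen from a point far behind [q], [F x] is then clearly farther than
    every point of [P], against [farthest]. *)
Let hull_dense x t : unit_ball x -> 0 < t -> exists2 q, hull q & sqdist q (F x) < t.
Proof.
move=> x1 t0; apply: contrapT => far.
have {}far q : hull q -> t <= sqdist q (F x).
  by move=> hq; rewrite leNgt; apply/negP => qt; apply: far; exists q.
pose A := [set sqdist q (F x) | q in hull].
have A0 : has_inf A.
  split; last by exists t => _ [q hq <-]; exact: far.
  have [p Pp _] := farthest 0 ltr01.
  by exists (sqdist p (F x)), p => //; exact: hull_point.
pose m := inf A; have tm : t <= m.
  by apply: lb_le_inf; [case: A0|move=> _ [q hq <-]; exact: far].
have m0 : 0 < m := lt_le_trans t0 tm.
have [D D0 FD] := F_diam.
(* The step length along the segment from [q] to [p]: the quadratic term [s ^+ 2 * sqdist p q] is at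
   most [s * (m / 4)], and [q] is taken within the same error of the infimum. This yields
   [dotr (p - q) a <= m / 4]. *)
pose s := Num.min 1 (m / (4 * D)).
have s0 : 0 < s by rewrite lt_min ltr01 divr_gt0// mulr_gt0.
have s1 : 0 <= s <= 1 by rewrite (ltW s0)/= ge_min lexx.
have sD : s * D <= m / 4.
  have : s <= m / (4 * D) by rewrite ge_min lexx orbT.
  rewrite ler_pdivlMr ?mulr_gt0// => sm; rewrite ler_pdivlMr//.
  by rewrite mulrAC -mulrA.
have [_ [q hq <-] qm] := inf_adherent (mulr_gt0 s0 (divr_gt0 m0 (ltr0n R 4))) A0.
pose a := F x - q; have am : m <= dotr a a.
  rewrite (_ : dotr a a = sqdist q (F x)).
    by apply: ge_inf; [case: A0|exists q].
  by rewrite /sqdist -opprB -scaleN1r dotrZl dotrZr mulN1r mulN1r opprK.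
have qE : sqdist q (F x) = dotr a a.
  by rewrite /sqdist -opprB -scaleN1r dotrZl dotrZr mulN1r mulN1r opprK.
have pa p : P p -> dotr (p - q) a <= m / 4.
  move=> Pp; have : m <= sqdist (q + s *: (p - q)) (F x).
    apply: ge_inf; first by case: A0.
    by exists (q + s *: (p - q)) => //; exact: hull_step.
  have -> : sqdist (q + s *: (p - q)) (F x) =
      dotr a a - 2 * s * dotr (p - q) a + s ^+ 2 * sqdist p q.
    rewrite /sqdist; have -> : q + s *: (p - q) - F x = (-1) *: a + s *: (p - q).
      by rewrite scaleN1r opprB addrAC.
    rewrite /sqdist; move: (p - q) (a) => b a'.
    rewrite !(dotrDl, dotrDr, dotrZl, dotrZr) [dotr b a']dotrC; ring.
  have [z z1 qz] := hull_ball hq; have [z' [z1' pz' _]] := Pp.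
  have : sqdist p q < D by rewrite qz pz'; exact: FD.
  move: qm; rewrite qE -/m => qm pD H.
  have : s ^+ 2 * sqdist p q <= s * (m / 4).
    rewrite expr2 -mulrA ler_pM2l//; apply: le_trans sD.
    by rewrite ler_pM2l// ltW.
  move=> H2; have : s * (2 * dotr (p - q) a) <= s * (2 * (m / 4)) by move: qm H H2; lra.
  by rewrite ler_pM2l//; lra.
(* The viewpoint is [q - l *: a]. In the comparison of squared distances the terms
   [l ^+ 2 * dotr a a] cancel, and [F x] wins by at least [2 * l * m] against
   [D + 1 + l * m / 2]. *)
pose l := (D + 1) / m; have lm : l * m = D + 1 by rewrite divfK ?gt_eqF.
have l0 : 0 < l by rewrite divr_gt0// ltr_wpDr.
have [p Pp] := farthest (q - l *: a) ltr01.
move=> /(_ x x1).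
have -> : sqdist (F x) (q - l *: a) = (1 + l) ^+ 2 * dotr a a.
  rewrite /sqdist; have -> : F x - (q - l *: a) = (1 + l) *: a.
    by rewrite scalerDl scale1r opprB addrCA addrC.
  by rewrite dotrZl dotrZr; ring.
have -> : sqdist p (q - l *: a) = sqdist p q + 2 * l * dotr (p - q) a + l ^+ 2 * dotr a a.
  rewrite /sqdist opprB addrCA addrC; move: (p - q) (a) => b a'.
  by rewrite !(dotrDl, dotrDr, dotrZl, dotrZr) [dotr a' _]dotrC; ring.
have [z z1 qz] := hull_ball hq; have [z' [z1' pz' _]] := Pp.
have : sqdist p q < D by rewrite qz pz'; exact: FD.
have := pa _ Pp.
rewrite -(ler_pM2l l0) => H1 H2 H3.
have H4 : l * m <= l * dotr a a by rewrite ler_pM2l.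
move: H1 H2 H3 H4; rewrite mulrA lm expr2; lra.
Qed.

(** In each coordinate, the combination of slices stays within [Num.sqrt eta] of a hull point, which
    itself is within [Num.sqrt eta] of [F x]; the square of the sum of both errors is [4 * eta]. *)
Lemma slices_near x : unit_ball x ->
  exists k (w : 'I_k -> R) (S : 'I_k -> set V),
  [/\ forall j, 0 <= w j, \sum_j w j = 1, forall j, is_slice (S j) &
    forall y, convex_combination w S y -> forall i, (g i y - g i x) ^+ 2 < 4 * eta].
Proof.
move=> x1; have [q [k [w [p [w0 w1 Pp ->]]]] qx] := hull_dense x1 eta0.
have [z zP] := choice Pp.
have sP j : exists S, is_slice S /\ forall y, S y -> sqdist (F y) (p j) < eta.
  by have [_ _ [S ? ?]] := zP j; exists S.
have [S SP] := choice sP.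
exists k, w, S; split => // [j|_ [y Sy ->] i]; first by case: (SP j).
have sq (b : R) : b ^+ 2 < eta -> `|b| < Num.sqrt eta.
  by move=> be; rewrite -sqrtr_sqr ltr_sqrt.
pose r := (\sum_j w j *: p j) ord0 i.
have rE : r = \sum_j w j * p j ord0 i.
  by rewrite /r summxE; apply: eq_bigr => j _; rewrite mxE.
have h1 : `|r - g i x| < Num.sqrt eta.
  apply: sq; apply: le_lt_trans qx; apply: le_trans (sqr_le_dotr _ i).
  by rewrite [in leRHS]mxE [in leRHS]mxE [X in _ <= (_ - X) ^+ 2]mxE.
have h2 : `|g i (\sum_(j < k) w j *: y j) - r| <= Num.sqrt eta.
  rewrite linear_sum rE -sumrB -[leRHS]mul1r -w1 mulr_suml.
  apply: le_trans (ler_norm_sum _ _ _) _; apply: ler_sum => j _.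
  rewrite linearZ -mulrBr normrM ger0_norm// ler_wpM2l//; apply/ltW/sq.
  have [_ /(_ _ (Sy j))] := SP j; apply: le_lt_trans.
  by apply: le_trans (sqr_le_dotr _ i); rewrite !mxE.
rewrite -real_normK ?num_real// -[X in _ < 4 * X]sqr_sqrtr ?(ltW eta0)//.
rewrite (_ : 4 * _ = (Num.sqrt eta + Num.sqrt eta) ^+ 2); last by ring.
rewrite ltrXn2r ?nnegrE//.
rewrite -(subrKA r); apply: le_lt_trans (ler_normD _ _) _.
exact: ler_ltD.
Qed.

End bourgain.

Lemma SD2P_D2P {R : realType} (V : normedModType R) : (exists x : V, x != 0) ->
  SD2P V -> D2P V.
Proof.
move=> [x0 nx0] sd W oW [x [Wx x1]]; apply/eqP; rewrite eq_le; apply/andP; split.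
  by apply: diam_le2 => y [].
have [n [g [e [e0 gW]]]] := weakly_open_basic oW Wx.
(* If all the functionals vanish, [W] is the whole space, and a unit vector and its opposite are at
   distance two. *)
have [/forallP g0|] := boolP [forall i, dual_norm (g i) == 0].
  pose u := `|x0|^-1 *: x0; have u1 : `|u| = 1.
    by rewrite normrZ normfV normr_id mulVf ?normr_eq0.
  have WT y : W y.
    by apply: gW => i; rewrite !(dual_norm0 (eqP (g0 i))) subrr normr0.
  have := @le_norm_diam _ _ (W `&` unit_ball) u (- u).
  rewrite opprK -mulr2n -scaler_nat normrZ u1 mulr1 normr_nat; apply.
    by split; [exact: WT|rewrite /unit_ball/= u1].
  by split; [exact: WT|rewrite /unit_ball/= normrN u1].
rewrite negb_forall => /existsP[i0 gi0].
have eta0 : 0 < (e / 2) ^+ 2 by rewrite exprn_gt0// divr_gt0.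
have [k [w [S [w0 w1 sS cS]]]] := slices_near gi0 eta0 x1.
rewrite -(sd _ w S w0 w1 sS); apply: diam_subset => y cy; split; last first.
  have [z Sz ->] := cy; apply: unit_ball_convex => // j.
  by have [f [d [_ _ SE]]] := sS j; have := Sz j; rewrite SE => -[].
apply: gW => i; have := cS _ cy i.
rewrite (_ : 4 * _ = e ^+ 2); last by field.
rewrite -real_normK ?num_real// ltr_pXn2r// nnegrE//.
exact: ltW.
Qed.

(** * Representatives in the Orlicz space *)

Section representatives.
Context d (T : measurableType d) (R : realType).
Variables (mu : {measure set T -> \bar R}) (phi : orliczFunction R).
Implicit Types (f g : T -> R) (x y : orliczSpace mu phi).
Local Open Scope quotient_scope.

(** Allows norms and modulars of a class to be computed with any explicit function, instead of the
    opaque choice [repr x]. *)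
Definition represents x f := [/\ measurable_fun setT f, finite_modular mu phi f &
  (repr x : T -> R) = f %[ae mu]].

Lemma represents_ex f : measurable_fun setT f -> finite_modular mu phi f ->
  exists x, represents x f.
Proof.
move=> mf hf.
pose m := isMeasurableFun.Build _ _ _ _ f mf.
pose f' : {mfun T >-> R} := HB.pack f m.
have f'P : f' \in orlicz_class mu phi by rewrite inE.
exists (\pi_(orliczSpace mu phi) (OrliczFun f'P)); split => //.
exact: orlicz_repr_pi.
Qed.

Lemma represents_repr x : represents x (repr x).
Proof. by split; [exact: orliczFun_measurable|exact: orliczFun_finite|exact: ae_eq_refl]. Qed.

Lemma represents_norm x f : represents x f -> `|x| = luxemburg_norm mu phi f.
Proof.
by move=> [mf hf xf]; apply: ae_eq_luxemburg => //; exact: orliczFun_measurable.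
Qed.

Lemma representsZ a x f : represents x f -> represents (a *: x) (fun t => a * f t).
Proof.
move=> [mf hf xf]; split; [exact: measurable_funM|exact: finite_modularZ|].
rewrite -[x]reprK [a *: _]orlicz_pi_scale.
apply: (ae_eq_trans (orlicz_repr_pi _)).
by apply: filterS xf => t /= xf _; rewrite -xf.
Qed.

Lemma representsD x y f g : represents x f -> represents y g ->
  represents (x + y) (fun t => f t + g t).
Proof.
move=> [mf hf xf] [mg hg yg]; split; [exact: measurable_funD|exact: finite_modularD|].
rewrite -[x]reprK -[y]reprK orlicz_pi_add.
apply: (ae_eq_trans (orlicz_repr_pi _)).
by apply: filterS2 xf yg => t /= xf yg _; rewrite -xf// -yg.
Qed.

Lemma representsB x y f g : represents x f -> represents y g ->
  represents (x - y) (fun t => f t - g t).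
Proof.
move=> xf yg; rewrite -scaleN1r.
rewrite (_ : (fun t => f t - g t) = (fun t => f t + (-1) * g t)).
  by apply: representsD => //; exact: representsZ.
by apply/funext => t; rewrite mulN1r.
Qed.

Lemma represents0 : represents 0 (fun=> 0).
Proof.
have := representsZ 0 (represents_repr 0); rewrite scale0r.
by rewrite (_ : (fun t => _) = fun=> 0)//; apply/funext => t; rewrite mul0r.
Qed.

Lemma represents_sum n (x : 'I_n -> orliczSpace mu phi) (f : 'I_n -> T -> R) :
  (forall i, represents (x i) (f i)) ->
  represents (\sum_(i < n) x i) (fun t => \sum_(i < n) f i t).
Proof.
elim: n x f => [|n ih] x f xf.
  rewrite big_ord0 (_ : (fun t => _) = fun=> 0); first exact: represents0.
  by apply/funext => t; rewrite big_ord0.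
rewrite big_ord_recl.
rewrite (_ : (fun t => _) = (fun t => f ord0 t + \sum_(i < n) f (lift ord0 i) t)).
  by apply: representsD => //; exact: ih.
by apply/funext => t; rewrite big_ord_recl.
Qed.

Lemma modular_le1_norm x f : represents x f ->
  (modular mu phi f <= 1)%E -> `|x| <= 1.
Proof.
move=> xf f1; rewrite (represents_norm xf); apply: luxemburg_le => //.
by rewrite (@modular_norm _ _ _ _ _ _ f)// => t; rewrite divr1.
Qed.

Lemma modular_gt1_norm x f l : represents x f -> 0 < l ->
  (1 < modular mu phi (fun t => l * f t)%R)%E -> l^-1 <= `|x|.
Proof.
move=> xf l0 lf1; rewrite (represents_norm xf) leNgt; apply/negP => fl.
move: lf1; apply/negP; rewrite -leNgt.
have [mf hf _] := xf; have := luxemburg_lt mf hf fl.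
by rewrite (@modular_norm _ _ _ _ _ _ (fun t => l * f t))// => t; rewrite invrK mulrC.
Qed.

Lemma modular_scale_le1_norm x f l : represents x f -> 0 < l ->
  (modular mu phi (fun t => l * f t)%R <= 1)%E -> `|x| <= l^-1.
Proof.
move=> xf l0 f1; rewrite (represents_norm xf); apply: luxemburg_le; rewrite ?invr_gt0//.
by rewrite (@modular_norm _ _ _ _ _ _ (fun t => l * f t))// => t; rewrite invrK mulrC.
Qed.

(** Here [f / c] has modular at most 1, and [f] is [c] times it; convexity and [phi 0 = 0] bring out
    the factor [c]. *)
Lemma norm_lt_modular x f (c : R) : represents x f -> c <= 1 -> `|x| < c ->
  (modular mu phi f <= c%:E)%E.
Proof.
move=> xf c1 xc; have c0 : 0 < c := le_lt_trans (normr_ge0 _) xc.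
have [mf hf _] := xf; rewrite (represents_norm xf) in xc.
have := luxemburg_lt mf hf xc => fc.
have mfc : measurable_fun setT (fun t => f t / c) by exact: measurable_funM.
have c01 : 0 <= c <= 1 by rewrite (ltW c0).
have := modular_scale mu phi mfc c01.
rewrite (@modular_norm _ _ _ _ _ _ f); last first.
  by move=> t; rewrite mulrC divfK// gt_eqF.
move=> /le_trans; apply; rewrite -[leRHS]mule1 lee_wpmul2l// lee_fin.
exact: ltW.
Qed.

End representatives.

(** * Modulars of restrictions to measurable sets *)

Section restriction.
Context d (T : measurableType d) (R : realType).
Variables (mu : {measure set T -> \bar R}) (phi : orliczFunction R).
Implicit Types (f g : T -> R) (A : set T).

Lemma measurable_indicM f A : measurable A -> measurable_fun setT f ->
  measurable_fun setT (fun t => \1_A t * f t).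
Proof. by move=> mA mf; apply: measurable_funM => //; exact: measurable_indic. Qed.

Lemma modular_indicM f A : measurable A ->
  modular mu phi (fun t => \1_A t * f t)%R = (\int[mu]_(t in A) phi `|f t|%R)%E.
Proof.
move=> mA; rewrite [RHS]integral_mkcond; apply: eq_integral => t _.
rewrite patchE indicE; case: ifPn => tA; first by rewrite mul1r.
by rewrite mul0r normr0 orlicz0.
Qed.

Lemma modular_split f A : measurable A -> measurable_fun setT f ->
  modular mu phi f = (\int[mu]_(t in A) phi `|f t|%R +
    modular mu phi (fun t => \1_(~` A) t * f t)%R)%E.
Proof.
move=> mA mf; rewrite modular_indicM; last exact: measurableC.
rewrite /modular -(setUv A) ge0_integral_setU//.
- exact: measurableC.
- by rewrite setUv; exact: measurable_modular.
- by move=> t _; exact: orlicz_ge0.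
- by rewrite disj_set2E setICr.
Qed.

Lemma modular_cst_indic u A : 0 <= u -> measurable A ->
  modular mu phi (fun t => u * \1_A t)%R = (phi u * mu A)%E.
Proof.
move=> u0 mA; rewrite (@modular_norm _ _ _ _ _ _ (fun t => \1_A t * u)); last first.
  by move=> t; rewrite mulrC.
rewrite (modular_indicM (fun=> u))//.
rewrite ger0_norm//. exact: integral_cst.
Qed.

Lemma finite_modular_le f g : measurable_fun setT f -> measurable_fun setT g ->
  (forall t, `|f t| <= `|g t|) -> finite_modular mu phi g -> finite_modular mu phi f.
Proof.
move=> mf mg fg [l l0 hl]; exists l => //; apply: le_lt_trans hl.
apply: modular_le; do ?exact: measurable_funM.
by move=> t; rewrite !normrM ler_wpM2l.
Qed.

Lemma finite_modular_lty f : (modular mu phi f < +oo)%E -> finite_modular mu phi f.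
Proof.
move=> hf; exists 1 => //.
by rewrite (@modular_norm _ _ _ _ _ _ f)// => t; rewrite mul1r.
Qed.

End restriction.

(** * Failure of the doubling condition *)

(** Evaluate [f] at the combination whose coefficients are the signs of the [f (z j)]. *)
Lemma sum_dual_le {R : realType} {V : normedModType R} (f : dual V) N (z : 'I_N -> V) :
  (forall s : 'I_N -> R, (forall j, `|s j| <= 1) -> `|\sum_j s j *: z j| <= 1) ->
  \sum_j `|f (z j)| <= dual_norm f.
Proof.
move=> z1; pose s j := Num.sg (f (z j)).
have s1 j : `|s j| <= 1 by rewrite normr_sg; case: (_ == _); rewrite ?ler01.
have -> : \sum_j `|f (z j)| = f (\sum_j s j *: z j).
  by rewrite linear_sum; apply: eq_bigr => j _; rewrite linearZ/= [LHS]normrEsg.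
exact: unit_ball_dual_le (z1 s s1).
Qed.

Lemma exists_pos_lower_bound {R : realType} n (e : 'I_n -> R) :
  (forall i, 0 < e i) -> exists2 r, 0 < r & forall i, r <= e i.
Proof.
move=> e0; exists (\big[Order.min/1]_(i < n) e i); last by move=> i; exact: bigmin_le.
by apply: lt_bigmin.
Qed.

Section disjoint_supports.
Context d (T : measurableType d) (R : realType).
Variables (mu : {measure set T -> \bar R}) (phi : orliczFunction R).

Lemma disjoint_indic_sum_le N (A : 'I_N -> set T) (s : 'I_N -> R) (f : T -> R) t :
  trivIset setT A -> (forall j, `|s j| <= 1) ->
  `|\sum_j s j * (\1_(A j) t * f t)| <= `|\1_(\bigcup_j A j) t * f t|.
Proof.
move=> tA s1; have [[j _ Aj]|nA] := pselect ((\bigcup_j A j) t).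
  rewrite (bigD1 j)//= big1 ?addr0; last first.
    move=> i ij; rewrite indicE memNset ?mul0r ?mulr0// => Ai.
    by move/eqP: ij; apply; apply: tA => //; exists t.
  rewrite !indicE !mem_set//; last by exists j.
  by rewrite !mul1r normrM ler_piMl.
rewrite big1 ?normr0// => j _.
by rewrite indicE memNset ?mul0r ?mulr0// => Aj; apply: nA; exists j.
Qed.

(** The pieces of a function of modular at most 1 on disjoint sets may be multiplied by arbitrary
    signs without leaving the ball, so a functional is small on most pieces. *)
Lemma sum_dual_disjoint_le (g : dual (orliczSpace mu phi)) N (A : 'I_N -> set T)
    (f : T -> R) (x : 'I_N -> orliczSpace mu phi) :
  trivIset setT A -> (forall j, measurable (A j)) -> measurable_fun setT f ->
  (modular mu phi (fun t => \1_(\bigcup_j A j) t * f t)%R <= 1)%E ->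
  (forall j, represents (x j) (fun t => \1_(A j) t * f t)) ->
  \sum_j `|g (x j)| <= dual_norm g.
Proof.
move=> tA mA mf f1 xf; apply: sum_dual_le => s s1.
have sx : represents (\sum_j s j *: x j) (fun t => \sum_j s j * (\1_(A j) t * f t)).
  by apply: represents_sum => j; exact: representsZ.
apply: (modular_le1_norm sx); apply: le_trans f1.
apply: modular_le; first by case: sx.
  apply: measurable_indicM => //.
  by apply: fin_bigcup_measurable => //; exact: finite_finset.
by move=> t; exact: disjoint_indic_sum_le.
Qed.

(* The form in which the failure of the Delta_2 condition is used: the functions
   [u 1_(A j)] have small total modular although each has norm at least [1 / l]. *)
Definition spread_condition := forall (l eps : R) N, 1 < l -> 0 < eps ->
  exists (u : R) (A : 'I_N -> set T), [/\ 0 <= u, trivIset setT A,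
    forall j, measurable (A j), (phi u * mu (\bigcup_j A j) <= eps%:E)%E &
    forall j, (1 < phi (l * u)%R * mu (A j))%E].

Hypothesis spread : spread_condition.

Lemma spread_common_perturbation n (f : 'I_n -> dual (orliczSpace mu phi))
    (x : 'I_n -> orliczSpace mu phi) (e c l : R) :
  (forall i, dual_norm (f i) = 1) -> (forall i, `|x i| < c) -> c < 1 -> 0 < e -> 1 < l ->
  exists (z : 'I_n -> orliczSpace mu phi) (h : orliczSpace mu phi), l^-1 <= `|h| /\
    forall i, [/\ `|z i + h| <= 1, `|z i - h| <= 1,
      f i (x i) - e < f i (z i + h) & f i (x i) - e < f i (z i - h)].
Proof.
move=> f1 xc c1 e0 l1; have l0 : 0 < l := lt_trans ltr01 l1.
(* Over all [i] and [j], the values on the pieces sum to at most [2 * n]. As [N * e] exceeds this,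
   some [j] is good for all [i] at once. *)
pose N := (Num.truncn (2 * n%:R / e)).+1.
(* The [x i] have modular at most [c]; the remaining [1 - c] is the room for [h]. *)
have eps0 : 0 < 1 - c by rewrite subr_gt0.
have [u [A [u0 tA mA uA luA]]] := spread N l1 eps0.
pose U := \bigcup_j A j.
have mU : measurable U by apply: fin_bigcup_measurable => //; exact: finite_finset.
pose F i : T -> R := repr (x i).
have xF i : represents (x i) (F i) by exact: represents_repr.
have mF i : measurable_fun setT (F i) by case: (xF i).
have IF i : (modular mu phi (F i) <= c%:E)%E.
  exact: (norm_lt_modular (xF i) (ltW c1) (xc i)).
have Iu B : measurable B -> modular mu phi (fun t => \1_B t * u)%R = (phi u * mu B)%E.
  move=> mB; rewrite -modular_cst_indic//; apply: modular_norm => t.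
  by rewrite mulrC.
have uAj j : (phi u * mu (A j) <= (1 - c)%:E)%E.
  apply: le_trans uA; apply: lee_wpmul2l; first exact: orlicz_ge0.
  by apply: le_measure; rewrite ?inE//; exact: bigcup_sup.
have mcu : measurable_fun setT (fun _ : T => u) by exact: measurable_cst.
have hP j : exists h : orliczSpace mu phi, represents h (fun t => \1_(A j) t * u).
  apply: represents_ex; first exact: measurable_indicM.
  by apply: finite_modular_lty; rewrite Iu//; apply: le_lt_trans (uAj j) _; rewrite ltry.
have [h hR] := choice hP.
have indic1 (B : set T) t (r : R) : `|\1_B t * r| <= `|r|.
  rewrite normrM ler_piMl// indicE; case: (_ \in _); rewrite ?normr1 ?normr0//.
have zP ij : exists z : orliczSpace mu phi,
    represents z (fun t => \1_(A ij.2) t * F ij.1 t).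
  apply: represents_ex; first exact: measurable_indicM.
  apply: (@finite_modular_le _ _ _ _ _ _ (F ij.1)) => //; first exact: measurable_indicM.
  by case: (xF ij.1).
have [z zR'] := choice zP.
have zR i j : represents (z (i, j)) (fun t => \1_(A j) t * F i t) := zR' (i, j).
have sumh i : \sum_j `|f i (h j)| <= 1.
  rewrite -(f1 i); apply: (@sum_dual_disjoint_le _ _ A (fun=> u)) => //.
  rewrite Iu//; apply: le_trans uA _; rewrite lee_fin gerBl.
  exact: le_trans (normr_ge0 _) (ltW (xc i)).
have sumz i : \sum_j `|f i (z (i, j))| <= 1.
  rewrite -(f1 i); apply: (@sum_dual_disjoint_le _ _ A (F i)) => //.
  apply: (@le_trans _ _ c%:E); last by rewrite lee_fin ltW.
  by apply: le_trans (IF i); apply: modular_le => //; exact: measurable_indicM.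
have [j small] : exists j, forall i, `|f i (h j)| + `|f i (z (i, j))| < e.
  apply: contrapT => big.
  have {}big j : e <= \sum_i (`|f i (h j)| + `|f i (z (i, j))|).
    rewrite leNgt; apply/negP => lte; apply: big; exists j => i.
    apply: le_lt_trans lte; rewrite [leRHS](bigD1 i)//= lerDl.
    by apply: sumr_ge0 => k _; rewrite addr_ge0.
  have : \sum_(j < N) e <= 2 * n%:R.
    apply: le_trans (ler_sum _ (fun j _ => big j)) _; rewrite exchange_big/=.
    apply: (@le_trans _ _ (\sum_(i < n) 2)); last first.
      by rewrite sumr_const card_ord mulr_natr.
    apply: ler_sum => i _; rewrite big_split/= (_ : 2 = 1 + 1)//.
    exact: lerD.
  rewrite sumr_const card_ord -[X in X <= _]mulr_natl -ler_pdivlMr//.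
  by apply/negP; rewrite -ltNge truncnS_gt.
exists (fun i => x i - z (i, j)), (h j); split.
  apply: (modular_gt1_norm (hR j) l0); apply: lt_le_trans (luA j) _.
  rewrite -modular_cst_indic ?mulr_ge0// ?(ltW l0)//.
  by rewrite le_eqVlt; apply/orP; left; apply/eqP/modular_norm => t; congr `|_|; ring.
(* On [A j] only [s *: h j] is left, with modular at most [1 - c]; off [A j] only [x i] is left,
   with modular at most [c]. *)
have ball (s : R) i : `|s| = 1 -> `|x i - z (i, j) + s *: h j| <= 1.
  move=> s1.
  have yR := representsD (representsB (xF i) (zR i j)) (representsZ s (hR j)).
  apply: (modular_le1_norm yR).
  have mG : measurable_fun setT (fun t => F i t - \1_(A j) t * F i t + s * (\1_(A j) t * u)).
    by case: yR.
  rewrite (modular_split _ _ (mA j) mG).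
  rewrite (_ : 1%E = ((1 - c)%:E + c%:E)%E); last by rewrite -EFinD subrK.
  apply: leeD.
    rewrite (eq_integral (cst (phi u))); last first.
      move=> t; rewrite inE => At; rewrite indicE mem_set//.
      by rewrite !mul1r subrr add0r normrM s1 mul1r ger0_norm.
    by rewrite integral_cst.
  apply: le_trans (IF i); apply: modular_le => //.
    by apply: measurable_indicM => //; exact: measurableC.
  move=> t; rewrite !indicE; have [At|At] := pselect (A j t).
    by rewrite memNset ?mul0r ?normr0// => /(_ At).
  by rewrite mem_set// memNset// !mul0r mulr0 subr0 addr0 mul1r.
move=> i; have := small i; set a := f i (h j); set b := f i (z (i, j)) => ab.
have := ler_norm a; have := ler_norm b; have := ler_norm (- a); rewrite normrN.
split.
- by have := ball 1 i (normr1 _); rewrite scale1r.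
- by have := ball (-1) i (normrN1 _); rewrite scaleN1r.
- by rewrite linearD linearB/=; rewrite -/a -/b; lra.
- by rewrite linearB linearB/=; rewrite -/a -/b; lra.
Qed.

Lemma spread_SD2P : SD2P (orliczSpace mu phi).
Proof.
move=> n w S w0 w1 sS; apply/eqP; rewrite eq_le; apply/andP; split.
  apply: diam_le2 => y [v Sv ->]; apply: unit_ball_convex => // i.
  by have [f [e [_ _ SE]]] := sS i; have := Sv i; rewrite SE => -[].
have fP i : exists fe : dual (orliczSpace mu phi) * R,
    [/\ dual_norm fe.1 = 1, 0 < fe.2 & S i = slice fe.1 fe.2].
  by have [f [e ?]] := sS i; exists (f, e).
have [fe feP] := choice fP.
have [e e0 ele] : exists2 e, 0 < e & forall i, e <= (fe i).2.
  by apply: exists_pos_lower_bound => i; case: (feP i).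
have e4 : 0 < e / 4 by rewrite divr_gt0.
have xP i : exists x, unit_ball x /\ 1 - e / 4 < (fe i).1 x.
  have [f1 _ _] := feP i; have [x x1 fx] := dual_norm_approx (fe i).1 e4.
  by exists x; rewrite -[X in X - _]f1.
have [x xx] := choice xP.
(* Shrinking by [1 - s] puts the points strictly inside the ball at a cost of at most [e / 4]. The
   choice of [x] and the perturbation cost [e / 4] each, so the total stays below [e]. *)
pose s := Num.min (e / 4) (1 / 2).
have s0 : 0 < s by rewrite lt_min e4 divr_gt0.
have [se s2] : s <= e / 4 /\ s <= 1 / 2 by rewrite /s !ge_min !lexx orbT.
apply/lee_addgt0Pr => r r0; pose l := 1 + r / 2.
have l2 : (2 - r) * l <= 2 by rewrite /l; have := sqr_ge0 r; lra.
have l1 : 1 < l by rewrite ltrDl divr_gt0.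
pose x' i := (1 - s) *: x i.
have x'c i : `|x' i| < 1 - s / 2.
  have [x1 _] := xx i; rewrite normrZ ger0_norm; last by lra.
  by apply: (@le_lt_trans _ _ (1 - s)); [rewrite ler_piMr//; lra|lra].
have c1 : 1 - s / 2 < 1 by lra.
have f1 i : dual_norm (fe i).1 = 1 by case: (feP i).
have [z [h [lh zh]]] := spread_common_perturbation f1 x'c c1 e4 l1.
have fx' i : 1 - e / 2 < (fe i).1 (x' i).
  have [x1 fx] := xx i; have -> : (fe i).1 (x' i) = (1 - s) * (fe i).1 (x i) by rewrite /x' linearZ.
  have := unit_ball_dual_le (fe i).1 x1; rewrite f1 => fx1.
  rewrite mulrBl mul1r; have : s * (fe i).1 (x i) <= s by rewrite ler_piMr// ltW.
  by move: fx se; lra.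
have Sp i : S i (z i + h).
  have [_ _ ->] := feP i; have [? _ fz _] := zh i; split => //=.
  by have := ele i; have := fx' i; lra.
have Sm i : S i (z i - h).
  have [_ _ ->] := feP i; have [_ ? _ fz] := zh i; split => //=.
  by have := ele i; have := fx' i; lra.
have := @le_norm_diam _ _ (convex_combination w S)
  (\sum_(i < n) w i *: (z i + h)) (\sum_(i < n) w i *: (z i - h)).
have -> : \sum_(i < n) w i *: (z i + h) - \sum_(i < n) w i *: (z i - h) = 2 *: h.
  rewrite -sumrB (eq_bigr (fun i => w i *: (2 *: h))).
    by rewrite -scaler_suml w1 scale1r.
  move=> i _; rewrite -scalerBr; congr (_ *: _).
  by rewrite opprB addrC addrA subrK scaler_nat mulr2n.
move=> H.
have {H} : ((`|2 *: h|)%:E <= diam (convex_combination w S))%E.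
  by apply: H; [exists (fun i => z i + h)|exists (fun i => z i - h)].
rewrite normrZ normr_nat => H; apply: le_trans (leeD2r _ H).
rewrite -EFinD lee_fin -lerBlDr; apply: (@le_trans _ _ (2 * l^-1)).
  by rewrite ler_pdivlMr// (lt_trans ltr01).
by rewrite ler_pM2l.
Qed.

End disjoint_supports.

(** * Non-atomic measures *)

Section nonatomic_measures.
Context d (T : measurableType d) (R : realType).
Variable mu : {measure set T -> \bar R}.
Hypothesis mu_na : nonatomic mu.

Section finite_set.
Variables (A : set T) (mA : measurable A) (Afin : (mu A < +oo)%E).

Local Notation m B := (fine (mu B)).

Let sub_fin B : measurable B -> B `<=` A -> (mu B < +oo)%E.
Proof. by move=> mB BA; apply: le_lt_trans Afin; apply: le_measure; rewrite ?inE. Qed.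

Lemma sub_measureE B : measurable B -> B `<=` A -> mu B = (m B)%:E.
Proof. by move=> mB BA; rewrite fineK// ge0_fin_numE// sub_fin. Qed.

Lemma fine_measureU B C : measurable B -> measurable C -> B `<=` A -> C `<=` A `\` B ->
  m (B `|` C) = m B + m C.
Proof.
move=> mB mC BA CAB; have CA : C `<=` A by move=> t /CAB[].
apply/eqP; rewrite -eqe -sub_measureE; last 2 first.
- exact: measurableU.
- by move=> t [/BA|/CA].
rewrite EFinD -!sub_measureE// measureU//; apply/seteqP; split => // t [Bt /CAB[_]].
by move=> /(_ Bt).
Qed.

Let mE := sub_measureE.
Let mU := fine_measureU.

(** A set of positive measure that is not an atom splits into two parts of positive measure, and the
    smaller part has at most half the measure. Iterate. *)
Lemma nonatomic_small_subset e : (0 < mu A)%E -> 0 < e ->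
  exists B, [/\ measurable B, B `<=` A, (0 < mu B)%E & (mu B <= e%:E)%E].
Proof.
move=> A0 e0.
have half B : measurable B -> B `<=` A -> 0 < m B ->
    exists C, [/\ measurable C, C `<=` B, 0 < m C & m C <= m B / 2].
  move=> mB BA B0; have nB : ~ atom mu B := @mu_na B.
  have [C [mC CB C0 BC0]] : exists C, [/\ measurable C, C `<=` B,
      mu C <> 0%E & mu (B `\` C) <> 0%E].
    apply: contrapT => noC; apply: nB; split => //; first by rewrite mE// lte_fin.
    move=> C mC CB; apply: contrapT => /not_orP[C0 BC0].
    by apply: noC; exists C.
  have CA := subset_trans CB BA.
  have mD : measurable (B `\` C) by exact: measurableD.
  have DA : B `\` C `<=` A by move=> t [/BA].
  have pos D : measurable D -> D `<=` A -> mu D <> 0%E -> 0 < m D.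
    move=> mD' DA' D0; rewrite lt_neqAle fine_ge0// andbT eq_sym.
    by apply/eqP => D0'; apply: D0; rewrite mE// D0'.
  have BE : m B = m C + m (B `\` C).
    by rewrite -mU// ?setDUK//; exact: setSD.
  have [le|/ltW le] := leP (m C) (m (B `\` C)).
    by exists C; split => //; [exact: pos|lra].
  by exists (B `\` C); split => //; [exact: pos|lra].
have A0' : 0 < m A by rewrite -lte_fin -mE.
have iterated n : exists C, [/\ measurable C, C `<=` A, 0 < m C & m C * 2 ^+ n <= m A].
  elim: n => [|n [C [mC CA C0 Cn]]]; first by exists A; rewrite expr0 mulr1; split.
  have [D [mD DC D0 Dn]] := half C mC CA C0.
  exists D; split => //; first exact: subset_trans CA.
  by apply: le_trans Cn; rewrite exprS mulrA ler_wpM2r ?exprn_ge0//; lra.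
pose n := Num.truncn (m A / e).
have [C [mC CA C0 Cn]] := iterated n.+1.
exists C; split => //; rewrite mE// ?lte_fin// lee_fin.
have : m A / e < n.+1%:R by exact: truncnS_gt.
rewrite ltr_pdivrMr// => An.
have n2 : n.+1%:R <= 2 ^+ n.+1 :> R by rewrite -natrX ler_nat ltnW// ltn_expl.
rewrite leNgt; apply/negP => eC; move: Cn; apply/negP; rewrite -ltNge.
apply: (lt_le_trans An); rewrite mulrC; apply: ler_pM => //; exact: ltW.
Qed.

End finite_set.

Section intermediate_values.
Variables (A : set T) (mA : measurable A) (Afin : (mu A < +oo)%E).

Local Notation m B := (fine (mu B)).
Let mE := sub_measureE mA Afin.
Let mU := fine_measureU mA Afin.

(* Greedy exhaustion: each step adds a set of at least half the largest possible
   measure, so that the measures of the added sets tend to 0. *)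
Lemma nonatomic_subset_measure a : 0 <= a -> (a%:E <= mu A)%E ->
  exists B, [/\ measurable B, B `<=` A & mu B = a%:E].
Proof.
move=> a0 aA; pose good B := [/\ measurable B, B `<=` A & m B <= a].
pose adm B C := [/\ measurable C, C `<=` A `\` B & m B + m C <= a].
have step B : exists C, good B -> adm B C /\ forall D, adm B D -> m D <= 2 * m C.
  have [gB|/asboolPn nB] := pselect (good B); last by exists set0 => /asboolP; rewrite (negbTE nB).
  have [mB BA Ba] := gB.
  have adm0 : adm B set0 by split => //; rewrite measure0 addr0.
  pose S := [set m D | D in adm B].
  have S0 : has_sup S.
    split; first by exists (m set0), set0.
    by exists a => _ [D [_ _ Da] <-]; apply: le_trans Da; rewrite lerDr.
  have [s0|s0] := leP (sup S) 0.
    exists set0 => _; split => // D aD; rewrite measure0 mulr0.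
    by apply: le_trans s0; apply: ub_le_sup; [case: S0|exists D].
  have s2 : 0 < sup S / 2 by rewrite divr_gt0.
  have [_ [C aC <-] sC] := sup_adherent s2 S0.
  exists C => _; split => // D aD.
  have : m D <= sup S by apply: ub_le_sup; [case: S0|exists D].
  by move: sC; set s := sup _; lra.
have [next nextP] := choice step.
pose F n := iter n (fun B => B `|` next B) set0.
have FS n : F n.+1 = F n `|` next (F n) by [].
have Fgood n : good (F n).
  elim: n => [|n ih]; first by split; rewrite /F/= ?measure0; [exact: measurable0|exact: sub0set|].
  have [[mC CAB Ca] _] := nextP _ ih; have [mB BA Ba] := ih.
  split; rewrite FS; first exact: measurableU.
  - by move=> t [/BA|/CAB[]].
  - by rewrite mU.
have mF n : measurable (F n) by case: (Fgood n).
have FA n : F n `<=` A by case: (Fgood n).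
have homF : {homo F : n k / (n <= k)%N >-> (n <= k)%O}.
  apply/nondecreasing_seqP => n; rewrite subsetEset FS; exact: subsetUl.
pose U := \bigcup_n F n.
have mUU : measurable U by apply: bigcup_measurable.
have UA : U `<=` A by apply: bigcup_sub => n _; exact: FA.
have Ua : m U <= a.
  rewrite -lee_fin -mE//; have cv := @nondecreasing_cvg_mu _ _ _ mu _ mF mUU homF.
  rewrite -(cvg_lim _ cv)//; apply: lime_le; first by apply/cvg_ex; exists (mu U).
  apply: nearW => n /=; rewrite mE// lee_fin; by case: (Fgood n).
exists U; split => //; rewrite mE//; congr EFin; apply/eqP; rewrite eq_le Ua/=.
rewrite leNgt; apply/negP => Ua'.
have mAU : measurable (A `\` U) by exact: measurableD.
have AE : m A = m U + m (A `\` U) by rewrite -mU// setDUK.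
have aA' : a <= m A by rewrite -lee_fin -mE.
have AU0 : (0 < mu (A `\` U))%E by rewrite mE ?subDsetl// lte_fin; lra.
(* If [m U < a], then some [D] of positive measure remains admissible at every stage. Each greedy
   step thus adds at least [m D / 2], so that the measures of the [F n] exceed [a] in the end. *)
have sub : exists D, [/\ measurable D, D `<=` A `\` U, 0 < m D & m D <= a - m U].
  have aU : 0 < a - m U by rewrite subr_gt0.
  have AUfin : (mu (A `\` U) < +oo)%E by rewrite mE ?ltry//; exact: subDsetl.
  have [D [mD DAU]] := nonatomic_small_subset mAU AUfin AU0 aU.
  have DA : D `<=` A by move=> t /DAU[].
  by rewrite mE// lte_fin lee_fin => D0 Da; exists D.
have [D [mD DU D0 Da]] := sub.
have grow n : n%:R * (m D / 2) <= m (F n).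
  elim: n => [|n ih]; first by rewrite mul0r.
  have [[mC CAB Ca] big] := nextP _ (Fgood n).
  have FU : F n `<=` U by exact: bigcup_sup.
  rewrite FS mU// -natr1 mulrDl mul1r lerD// ler_pdivrMr// mulrC; apply: big.
  split => //; first by move=> t /DU[At nUt]; split => // /FU.
  have mFU : m (F n) <= m U by rewrite -lee_fin -!mE//; apply: le_measure; rewrite ?inE.
  lra.
have D2 : 0 < m D / 2 by rewrite divr_gt0.
pose n := (Num.truncn (a / (m D / 2))).+1.
have : a / (m D / 2) < n%:R by exact: truncnS_gt.
rewrite ltr_pdivrMr// => an; have [_ _ Fa] := Fgood n.
by move: (le_lt_trans (grow n) (le_lt_trans Fa an)); rewrite ltxx.
Qed.

End intermediate_values.

Lemma nonatomic_disjoint_subsets N A a : measurable A -> (mu A < +oo)%E ->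
  0 <= a -> ((N%:R * a)%:E <= mu A)%E ->
  exists B : 'I_N -> set T, [/\ trivIset setT B, forall j, measurable (B j),
    forall j, B j `<=` A, forall j, mu (B j) = a%:E &
    (mu (\bigcup_j B j) <= (N%:R * a)%:E)%E].
Proof.
move=> + + a0; elim: N A => [|N ih] A mA Afin NA.
  exists (fun=> set0); split => //; [by move=> [] []..|].
  rewrite bigcup0// measure0 mul0r//.
have [B [mB BA Ba]] : exists B, [/\ measurable B, B `<=` A & mu B = a%:E].
  apply: (nonatomic_subset_measure mA Afin a0); apply: le_trans NA.
  by rewrite lee_fin -natr1 mulrDl mul1r lerDr mulr_ge0.
have mD : measurable (A `\` B) by exact: measurableD.
have ABE : mu A = (a%:E + mu (A `\` B))%E.
  by rewrite -Ba -measureU ?setDUK ?setDIK.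
have [||C [tC mC CA Ca CU]] := ih _ mD.
- by apply: le_lt_trans Afin; apply: le_measure; rewrite ?inE//; exact: subDsetl.
- move: NA; rewrite ABE -natr1 mulrDl mul1r addrC EFinD leeD2lE//.
exists (fun i => if unlift ord0 i is Some j then C j else B); split.
- move=> i j _ _; case: unliftP => [i'|] ->; case: unliftP => [j'|] -> // [t [/= h1 h2]].
  + by congr lift; apply: tC => //; exists t.
  + by have [] := CA _ _ h1.
  + by have [] := CA _ _ h2.
- by move=> i; case: unliftP.
- by move=> i; case: unliftP => // j _ t /CA[].
- by move=> i; case: unliftP.
- rewrite (_ : \bigcup_i _ = B `|` \bigcup_j C j); last first.
    apply/seteqP; split => t.
      by move=> [i _]; case: unliftP => [j _ Cj|_ Bt]; [right; exists j|left].
    by move=> [Bt|[j _ Cj]]; [exists ord0|exists (lift ord0 j)]; rewrite ?unlift_none ?liftK.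
  have mC' : measurable (\bigcup_j C j).
    by apply: fin_bigcup_measurable => //; exact: finite_finset.
  apply: le_trans (measureU2 _ mB mC') _.
  have -> : (N.+1%:R * a)%:E = (mu B + (N%:R * a)%:E)%E.
    by rewrite Ba -EFinD -natr1 mulrDl mul1r addrC.
  exact: leeD2l.
Qed.

End nonatomic_measures.

(** Continuity from below along an exhaustion by sets of finite measure; the strict inequality makes
    one of these sets reach [r]. *)
Lemma sigma_finite_large_subset d (T : measurableType d) (R : realType)
    (mu : {measure set T -> \bar R}) (r : R) :
  sigma_finite setT mu -> (r%:E < mu setT)%E ->
  exists A, [/\ measurable A, (mu A < +oo)%E & (r%:E <= mu A)%E].
Proof.
move=> /sigma_finiteP[F [UF homF FP]] rT.
have mF n : measurable (F n) by case: (FP n).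
apply: contrapT => small; move: rT; apply/negP; rewrite -leNgt UF.
have cv : mu \o F @ \oo --> mu (\bigcup_n F n).
  by apply: nondecreasing_cvg_mu => //; apply: bigcup_measurable.
rewrite -(cvg_lim _ cv)//; apply: lime_le; first by apply/cvg_ex; exists (mu (\bigcup_n F n)).
apply: nearW => n /=; rewrite leNgt; apply/negP => rF.
by apply: small; exists (F n); have [_ ?] := FP n; split => //; exact: ltW.
Qed.

(** * Finite Orlicz functions *)

Section finite_orlicz_functions.
Context {R : realType} (phi : orliczFunction R) (phi_fin : finite_orlicz phi).

(** The absolute value extends [phi] evenly to the whole line, so that continuity and integrands
    need no sign condition. *)
Definition orlicz_real (u : R) : R := fine (phi `|u|).

Local Notation G := orlicz_real.

Lemma orlicz_realE u : 0 <= u -> phi u = (G u)%:E.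
Proof.
move=> u0; rewrite /G ger0_norm// fineK// ge0_fin_numE ?orlicz_ge0//.
exact: phi_fin.
Qed.

Lemma orlicz_real_norm u : G `|u| = G u.
Proof. by rewrite /G normr_id. Qed.

Lemma orlicz_real_ge0 u : 0 <= G u.
Proof. by apply: fine_ge0; apply: orlicz_ge0. Qed.

Lemma orlicz_real0 : G 0 = 0.
Proof. by rewrite /G normr0 orlicz0. Qed.

Lemma orlicz_real_le u v : 0 <= u -> u <= v -> G u <= G v.
Proof.
move=> u0 uv; rewrite -lee_fin -!orlicz_realE ?orlicz_le//.
exact: le_trans uv.
Qed.

Lemma orlicz_real_convex t u v : 0 <= t <= 1 -> 0 <= u -> 0 <= v ->
  G (t * u + (1 - t) * v) <= t * G u + (1 - t) * G v.
Proof.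
move=> /[dup] t01 /andP[t0 t1] u0 v0; have := orlicz_convex phi t01 u0 v0.
have t1u : 0 <= t * u + (1 - t) * v by rewrite addr_ge0 ?mulr_ge0 ?subr_ge0.
by rewrite !orlicz_realE.
Qed.

Lemma orlicz_real_scale t u : 0 <= t <= 1 -> 0 <= u -> G (t * u) <= t * G u.
Proof.
move=> t01 u0; have := orlicz_real_convex t01 u0 (lexx 0).
by rewrite mulr0 addr0 orlicz_real0 mulr0 addr0.
Qed.

Lemma orlicz_real_chord u v w : 0 <= u -> u <= v <= w -> u < w ->
  (w - u) * G v <= (w - v) * G u + (v - u) * G w.
Proof.
move=> u0 /andP[uv vw] uw; have wu : 0 < w - u by rewrite subr_gt0.
have t01 : 0 <= (w - v) / (w - u) <= 1.
  by rewrite divr_ge0 ?subr_ge0//= ?(ltW uw)// ler_pdivrMr// mul1r; lra.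
have := orlicz_real_convex t01 u0 (le_trans u0 (ltW uw)).
have -> : (w - v) / (w - u) * u + (1 - (w - v) / (w - u)) * w = v.
  by field; rewrite gt_eqF.
rewrite -(ler_pM2l wu) => /le_trans; apply.
by rewrite le_eqVlt; apply/orP; left; apply/eqP; field; rewrite gt_eqF.
Qed.

(** By convexity the slope from [u] to [v] is at most the slope from [u] to [2 * M], a chord of
    length at least [M] and of height at most [G (2 * M)]. *)
Lemma orlicz_real_lipschitz u v M : 0 <= u -> u <= v <= M -> 0 < M ->
  G v - G u <= (v - u) * (G (2 * M) / M).
Proof.
move=> u0 /andP[uv vM] M0; rewrite mulrA ler_pdivlMr//.
have := @orlicz_real_chord u v (2 * M) u0.
have -> : u <= v <= 2 * M by rewrite uv; lra.
move=> /(_ isT) H; have {}H := H (ltac:(lra)).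
have Guv : 0 <= G v - G u by rewrite subr_ge0 orlicz_real_le.
have : (G v - G u) * M <= (G v - G u) * (2 * M - u) by apply: ler_wpM2l => //; lra.
have : 0 <= (v - u) * G u by rewrite mulr_ge0 ?subr_ge0 ?orlicz_real_ge0.
by lra.
Qed.

Lemma orlicz_real_continuous : continuous G.
Proof.
move=> u; apply/cvgrPdist_le => /= e e0.
pose M := `|u| + 1; have M0 : 0 < M by rewrite ltr_wpDl.
pose L := G (2 * M) / M + 1.
have L0 : 0 < L by rewrite ltr_wpDl// divr_ge0 ?orlicz_real_ge0// ltW.
have key a b : `|a| <= `|b| -> `|b| <= M -> `|b - a| <= e / L -> `|G b - G a| <= e.
  move=> ab bM bae; rewrite -(orlicz_real_norm a) -(orlicz_real_norm b).
  rewrite ger0_norm ?subr_ge0 ?orlicz_real_le//.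
  have := @orlicz_real_lipschitz `|a| `|b| M (normr_ge0 _); rewrite ab bM.
  move=> /(_ isT M0)/le_trans; apply.
  have {}bae : `|b| - `|a| <= e / L by apply: le_trans bae; exact: lerB_dist.
  apply: (@le_trans _ _ ((`|b| - `|a|) * L)).
    by apply: ler_wpM2l; rewrite ?subr_ge0// lerDl.
  by rewrite -ler_pdivlMr.
near=> v.
have uv1 : `|u - v| <= 1.
  by near: v; apply: cvgr_dist_le => //; exact: cvg_id.
have uve : `|u - v| <= e / L.
  by near: v; apply: cvgr_dist_le; [exact: cvg_id|rewrite divr_gt0].
have uM : `|u| <= M by rewrite lerDl.
have vM : `|v| <= M.
  by rewrite /M -lerBlDl; apply: le_trans uv1; rewrite distrC; exact: lerB_dist.
have [uv|/ltW uv] := leP `|u| `|v|.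
  by rewrite distrC; apply: key => //; rewrite distrC.
exact: key.
Unshelve. all: by end_near. Qed.

Lemma orlicz_real_pos : exists2 u, 0 < u & 0 < G u.
Proof.
have [u u0 /eqP pu] := orlicz_neq0 phi; exists u => //.
by move: pu; rewrite orlicz_realE ?ltW// eqe lt_neqAle eq_sym orlicz_real_ge0 => ->.
Qed.

Lemma orlicz_real_superlinear u v : 0 < u -> u <= v -> v * G u <= u * G v.
Proof.
move=> u0 uv; have v0 : 0 < v := lt_le_trans u0 uv.
have t01 : 0 <= u / v <= 1 by rewrite divr_ge0 ?(ltW u0) ?(ltW v0)//= ler_pdivrMr// mul1r.
have := orlicz_real_scale t01 (ltW v0); rewrite divfK ?gt_eqF//.
by rewrite mulrAC ler_pdivlMr// mulrC.
Qed.

Lemma orlicz_real_unbounded C : exists2 u, 0 < u & C <= G u.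
Proof.
have [u u0 Gu] := orlicz_real_pos.
have m0 : 0 < Num.max 1 (C / G u) by rewrite lt_max ltr01.
exists (u * Num.max 1 (C / G u)); first by rewrite mulr_gt0.
have := @orlicz_real_superlinear u (u * Num.max 1 (C / G u)) u0.
rewrite ler_pMr// le_max lexx => /(_ isT).
rewrite -mulrA ler_pM2l//; apply: le_trans.
by rewrite -ler_pdivrMr// le_max lexx orbT.
Qed.

Lemma expr_unbounded (l C : R) : 1 < l -> exists m : nat, C <= l ^+ m.
Proof.
move=> l1; have l0 : 0 < l - 1 by rewrite subr_gt0.
have bern (m : nat) : m%:R * (l - 1) <= l ^+ m.
  elim: m => [|m ih]; first by rewrite mul0r expr0.
  have lm : 1 <= l ^+ m by rewrite exprn_ege1// ltW.
  rewrite exprS -natr1 mulrDl mul1r.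
  have : l - 1 <= (l - 1) * l ^+ m by rewrite ler_peMr// ltW.
  by lra.
exists (Num.truncn (C / (l - 1))).+1; apply: le_trans (bern _).
by rewrite -ler_pdivrMr//; exact/ltW/truncnS_gt.
Qed.

(** [K] may be any real number; [Num.max 1 K] keeps the factors nonnegative throughout the
    iteration. *)
Lemma orlicz_real_iter (l K u : R) m :
  (forall j, (j < m)%N -> G (l * (l ^+ j * u)) <= K * G (l ^+ j * u)) ->
  G (l ^+ m * u) <= Num.max 1 K ^+ m * G u.
Proof.
elim: m => [|m ih] H; first by rewrite !expr0 !mul1r.
rewrite exprS -mulrA; apply: le_trans (H m (ltnSn m)) _.
apply: (@le_trans _ _ (Num.max 1 K * G (l ^+ m * u))).
  by rewrite ler_wpM2r ?orlicz_real_ge0// le_max lexx orbT.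
rewrite exprS -mulrA ler_wpM2l//; first by rewrite le_max ler01.
by apply: ih => j jm; apply: H; rewrite ltnS ltnW.
Qed.

(** Iterate the dilation until [l ^+ m] reaches 2. Read contrapositively: if doubling fails, then
    for every [l > 1], however close to 1, and every [K] there are points with
    [K * G u < G (l * u)]. *)
Lemma doubling_of_dilation l K u0 : 1 < l -> 0 <= u0 ->
  (forall u, u0 <= u -> G (l * u) <= K * G u) ->
  exists2 K', 2 < K' & forall u, u0 <= u -> (phi (2 * u)%R <= K'%:E * phi u)%E.
Proof.
move=> l1 u00 H; have [m lm] := expr_unbounded 2 l1.
exists (Num.max 1 K ^+ m + 3).
  by rewrite ltr_wpDl ?exprn_ge0 ?le_max ?ler01//; lra.
move=> u uu; have u0' := le_trans u00 uu.
rewrite !orlicz_realE ?mulr_ge0// -EFinM lee_fin.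
apply: (@le_trans _ _ (G (l ^+ m * u))).
  by rewrite orlicz_real_le ?mulr_ge0// ler_wpM2r.
apply: (@le_trans _ _ (Num.max 1 K ^+ m * G u)).
  apply: orlicz_real_iter => j _; apply: H; apply: le_trans uu _.
  by rewrite ler_peMl// exprn_ege1// ltW.
by rewrite ler_wpM2r ?orlicz_real_ge0// lerDl.
Qed.

Lemma dilation_of_not_Delta2 l K : 1 < l -> ~ Delta2 phi ->
  exists2 u, 0 <= u & K * G u < G (l * u).
Proof.
move=> l1 nD; apply: contrapT => nex; apply: nD.
have [|K' K2 H] := @doubling_of_dilation l K 0 l1 (lexx 0); last by exists K'.
by move=> u u0; rewrite leNgt; apply/negP => ?; apply: nex; exists u.
Qed.

Lemma dilation_of_not_Delta2_infty l K u0 : 1 < l -> 0 <= u0 -> ~ Delta2_infty phi ->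
  exists2 u, u0 <= u & K * G u < G (l * u).
Proof.
move=> l1 u00 nD; apply: contrapT => nex; apply: nD.
have [|K' K2 H] := @doubling_of_dilation l K u0 l1 u00.
  by move=> u uu0; rewrite leNgt; apply/negP => ?; apply: nex; exists u.
by exists K', u0; split => //; exact: phi_fin.
Qed.

Lemma dilation_of_not_Delta2_zero l K u0 : 1 < l -> 0 < u0 ->
  (forall u, 0 < u -> 0 < G u) -> ~ Delta2_zero phi ->
  exists2 u, 0 < u <= u0 & K * G u < G (l * u).
Proof.
move=> l1 u00 Gpos nD; apply: contrapT => nex; apply: nD.
have H u : 0 <= u <= u0 -> G (l * u) <= K * G u.
  move=> /andP[u0' uu]; have [->|un0] := eqVneq u 0.
    by rewrite mulr0 orlicz_real0 mulr0.
  rewrite leNgt; apply/negP => ?; apply: nex; exists u => //.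
  by rewrite uu andbT lt_neqAle eq_sym un0.
have [m lm] := expr_unbounded 2 l1.
have l0 : 0 < l := lt_trans ltr01 l1.
have lm0 : 0 < l ^+ m by rewrite exprn_gt0.
have v0 : 0 < u0 / l ^+ m by rewrite divr_gt0.
(* The range is divided by [l ^+ m] so that all the intermediate points [l ^+ j * u] stay below
   [u0]. *)
exists (Num.max 1 K ^+ m + 3), (u0 / l ^+ m); split.
- by rewrite ltr_wpDl ?exprn_ge0 ?le_max ?ler01//; lra.
- exact: ltW.
- by rewrite phi_fin ?(ltW v0)// orlicz_realE ?(ltW v0)// lte_fin Gpos.
- move=> u /andP[u0'] uu.
  rewrite !orlicz_realE ?mulr_ge0// -EFinM lee_fin.
  apply: (@le_trans _ _ (G (l ^+ m * u))).
    by rewrite orlicz_real_le ?mulr_ge0// ler_wpM2r.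
  apply: (@le_trans _ _ (Num.max 1 K ^+ m * G u)).
    apply: orlicz_real_iter => j jm; apply: H.
    rewrite mulr_ge0 ?exprn_ge0 ?(ltW l0)//=.
    move: uu; rewrite ler_pdivlMr// mulrC; apply: le_trans.
    by rewrite ler_wpM2r// ler_weXn2l ?(ltW l1)// ltnW.
  by rewrite ler_wpM2r ?orlicz_real_ge0// lerDl.
Qed.

End finite_orlicz_functions.

(** * The spread condition from the failure of the doubling condition *)

Section spread.
Context {R : realType} (phi : orliczFunction R) (phi_fin : finite_orlicz phi).

Local Notation G := (orlicz_real phi).
Let GE := orlicz_realE phi_fin.

(** Only a height [u] and a common measure [a] of the sets have to be found: non-atomicity then
    carves [N] disjoint sets of measure [a] out of a set of finite measure. *)
Lemma nonatomic_spread d (T : measurableType d) (mu : {measure set T -> \bar R}) :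
  sigma_finite setT mu -> (0 < mu setT)%E -> nonatomic mu ->
  ~ Delta2_nonatomic phi mu -> spread_condition mu phi.
Proof.
move=> sf mu0 na nD l eps N l1 eps0; have l0 : 0 < l := lt_trans ltr01 l1.
suff [u [a [u0 a0 Ga lGa Na]]] : exists u a : R, [/\ 0 <= u, 0 <= a,
    G u * (N%:R * a) <= eps, 1 < G (l * u) * a & ((N%:R * a)%:E <= mu setT)%E].
  have [A [mA Afin NA]] : exists A, [/\ measurable A, (mu A < +oo)%E
      & ((N%:R * a)%:E <= mu A)%E].
    have [muT|muT] := eqVneq (mu setT) +oo%E.
      by apply: sigma_finite_large_subset; rewrite // muT ltry.
    by exists setT; split => //; rewrite ltey.
  have [B [tB mB _ Ba UB]] := nonatomic_disjoint_subsets na mA Afin a0 NA.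
  exists u, B; split => //.
    rewrite GE//; apply: le_trans (lee_wpmul2l _ UB) _.
      by rewrite lee_fin orlicz_real_ge0.
    by rewrite -EFinM lee_fin.
  by move=> j; rewrite Ba GE ?mulr_ge0 ?(ltW l0)// -EFinM lte_fin.
(* For [a = eps / N.+1%:R / G u] this gives [K * G u * a = 1] and [G u * (N%:R * a) <= eps]. The
   successor keeps the quotient meaningful for [N = 0]. *)
pose K := N.+1%:R / eps.
have GuK u : 0 <= u -> 0 < G u -> K * G u < G (l * u) -> exists a : R, [/\ 0 <= a,
    G u * (N%:R * a) <= eps, 1 < G (l * u) * a & N%:R * a <= eps / G u].
  move=> u0 Gu KG; have N1 : 0 < N.+1%:R :> R by rewrite ltr0n.
  have NN : N%:R <= N.+1%:R :> R by rewrite ler_nat.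
  have aE : N%:R * (eps / N.+1%:R / G u) <= eps / G u.
    rewrite mulrA ler_pM2r ?invr_gt0// mulrCA ler_piMr ?(ltW eps0)//.
    by rewrite ler_pdivrMr// mul1r.
  exists (eps / N.+1%:R / G u); split => //.
  - by rewrite divr_ge0 ?divr_ge0 ?(ltW eps0) ?(ltW Gu).
  - by rewrite mulrC -ler_pdivlMr.
  - apply: le_lt_trans (_ : K * G u * (eps / N.+1%:R / G u) < _).
      rewrite /K le_eqVlt; apply/orP; left; apply/eqP; field.
      by rewrite !gt_eqF//; rewrite -natr1 in N1; rewrite addrC.
    by rewrite ltr_pM2r// !divr_gt0.
move: nD; rewrite /Delta2_nonatomic; case: ifPn => [/eqP muT|muT] nD.
  have [u u0 KG] := dilation_of_not_Delta2 phi_fin K l1 nD.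
  have [Gu|Gu] := ltP 0 (G u).
    have [a [a0 Ga lGa Na]] := GuK u u0 Gu KG.
    by exists u, a; rewrite muT leey.
  have {}Gu : G u = 0 by apply/eqP; rewrite eq_le Gu orlicz_real_ge0.
  move: KG; rewrite Gu mulr0 => KG.
  (* When [G u = 0] the bound by [eps] is void; the measure being infinite, [a] may be any number
     above [1 / G (l * u)]. *)
  exists u, (2 / G (l * u)); rewrite Gu mul0r muT leey; split => //; last 2 first.
  - exact: ltW.
  - by rewrite mulrCA divff ?gt_eqF// mulr1 ltr1n.
  - by rewrite divr_ge0// ltW.
have muE : mu setT = (fine (mu setT))%:E by rewrite fineK// ge0_fin_numE// ltey.
have m0 : 0 < fine (mu setT) by rewrite -lte_fin -muE.
(* On a space of finite measure, [u] must be so large that [N] sets of measure [a] fit: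
   [N%:R * a <= eps / G u <= fine (mu setT)]. *)
have [u1 u10 u1G] := orlicz_real_unbounded phi_fin (eps / fine (mu setT)).
have [u u1u KG] := dilation_of_not_Delta2_infty phi_fin K l1 (ltW u10) nD.
have u0 : 0 <= u by apply: le_trans u1u; exact: ltW.
have Gu1 : eps / fine (mu setT) <= G u.
  by apply: le_trans u1G _; apply: orlicz_real_le => //; exact: ltW.
have Gu : 0 < G u by apply: lt_le_trans Gu1; rewrite divr_gt0.
have [a [a0 Ga lGa Na]] := GuK u u0 Gu KG.
exists u, a; split => //; rewrite muE lee_fin; apply: le_trans Na _.
by rewrite ler_pdivrMr// mulrC -ler_pdivrMr.
Qed.

(** The sets are consecutive blocks of [M] integers. Their measure has to be an integer, so rounding
    must be controlled; this is possible since [u] can be taken with [G u] small. *)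
Lemma counting_spread : ~ Delta2_zero phi -> spread_condition (@counting nat R) phi.
Proof.
move=> nD l eps N l1 eps0; have l0 : 0 < l := lt_trans ltr01 l1.
suff [u [M [u0 Ga lGa]]] : exists u (M : nat), [/\ 0 <= u,
    G u * (N * M)%:R <= eps & 1 < G (l * u) * M%:R].
  have M0 : (0 < M)%N.
    by rewrite lt0n; apply/negP => /eqP M0; move: lGa; rewrite M0 mulr0 ltr10.
  have cI n k : counting [set i | (n <= i < n + k)%N] = k%:R%:E :> \bar R.
    have -> : [set i | (n <= i < n + k)%N] = [set` seq_fset tt (iota n k)].
      have sE i : (i \in seq_fset tt (iota n k)) = (n <= i < n + k)%N.
        by rewrite seq_fsetE mem_iota.
      by apply/seteqP; split => i h; [exact: (etrans (sE i) h)|exact: (etrans (esym (sE i)) h)].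
    rewrite /counting asboolT; last exact: finite_fset.
    by rewrite set_fsetK size_seq_fset undup_id ?iota_uniq// size_iota.
  pose A (j : 'I_N) := [set i | (j * M <= i < j * M + M)%N].
  have cA j : counting (A j) = M%:R%:E :> \bar R by exact: cI.
  exists u, A; split => //.
  - move=> i j _ _ [t [/= /andP[i1 i2] /andP[j1 j2]]]; apply/val_inj/eqP => /=.
    have iE : (t %/ M)%N = i.
      by apply/eqP; rewrite eqn_leq leq_divRL// i1 andbT -ltnS ltn_divLR// mulSn addnC.
    have jE : (t %/ M)%N = j.
      by apply/eqP; rewrite eqn_leq leq_divRL// j1 andbT -ltnS ltn_divLR// mulSn addnC.
    by rewrite -iE jE.
  - have le : (counting (\bigcup_j A j) <=
        (N * M)%:R%:E :> \bar R)%E.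
      rewrite -(cI 0%N); apply: le_measure; rewrite ?inE//.
      move=> i [j _ /= /andP[_ ij]]; rewrite add0n; apply: leq_trans ij _.
      by rewrite addnC -mulSn leq_mul2r ltn_ord orbT.
    rewrite GE//; apply: le_trans (lee_wpmul2l _ le) _.
      by rewrite lee_fin orlicz_real_ge0.
    by rewrite -EFinM lee_fin.
  - by move=> j; rewrite [X in (_ * X)%E]cA GE ?mulr_ge0 ?(ltW l0)// -EFinM lte_fin.
(* If [G] vanishes at some [b > 0], the powers [l ^+ m * b] must at some point leave the zero set of
   [G]; the last zero before that costs no modular and [M] is free. *)
have [[b b0 Gb]|Gpos] := pselect (exists2 b, 0 < b & G b = 0).
  have [u [u0 Gu Glu]] : exists u, [/\ 0 <= u, G u = 0 & 0 < G (l * u)].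
    apply: contrapT => nex.
    have zero m : G (l ^+ m * b) = 0.
      elim: m => [|m ih]; first by rewrite mul1r.
      apply/eqP; rewrite eq_le orlicz_real_ge0 andbT leNgt; apply/negP => Glm.
      apply: nex; exists (l ^+ m * b); split => //; last by rewrite mulrA -exprS.
      by rewrite mulr_ge0 ?exprn_ge0 ?(ltW l0) ?(ltW b0).
    have [u u0 Gu] := orlicz_real_pos phi_fin.
    have [m um] := expr_unbounded (u / b) l1.
    move: um; rewrite ler_pdivrMr// => um.
    have := orlicz_real_le phi_fin (ltW u0) um; rewrite zero.
    by apply/negP; rewrite -ltNge.
  exists u, (Num.truncn (1 / G (l * u))).+1; split => //; first by rewrite Gu mul0r ltW.
  by rewrite mulrC -ltr_pdivrMr// truncnS_gt.
have {}Gpos u : 0 < u -> 0 < G u.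
  move=> u0; rewrite lt_neqAle orlicz_real_ge0 andbT eq_sym; apply/eqP => Gu.
  by apply: Gpos; exists u.
pose r := eps / N.+1%:R; have r0 : 0 < r by rewrite divr_gt0.
have [u0 u00 Gu0] : exists2 u0, 0 < u0 & G u0 <= r.
  have G1 : 0 < G 1 by exact: Gpos.
  have t0 : 0 < Num.min 1 (r / G 1) by rewrite lt_min ltr01 divr_gt0.
  exists (Num.min 1 (r / G 1)) => //.
  have t01 : 0 <= Num.min 1 (r / G 1) <= 1 by rewrite (ltW t0) ge_min lexx.
  have := orlicz_real_scale phi_fin t01 ler01; rewrite mulr1 => /le_trans; apply.
  by rewrite -ler_pdivlMr// ge_min lexx orbT.
(* [G u <= r] makes [r / G u] at least 1, so that its integer part [M] is more than half of it. The
   2 in [2 / r] pays for this rounding. *)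
have [u /andP[u1 uu0] KG] := dilation_of_not_Delta2_zero phi_fin (2 / r) l1 u00 Gpos nD.
have Gu := Gpos u u1.
have Gur : G u <= r by apply: le_trans Gu0; apply: orlicz_real_le => //; exact: ltW.
pose M := Num.truncn (r / G u).
have rG0 : 0 <= r / G u by rewrite divr_ge0 ?(ltW r0) ?(ltW Gu).
have Mle : M%:R <= r / G u by rewrite truncn_le.
have M1 : (1 <= M)%N by rewrite truncn_gt_nat ler_pdivlMr// mul1r.
have rM : r / G u < 2 * M%:R.
  apply: lt_le_trans (truncnS_gt _) _; rewrite -/M -natrM ler_nat mul2n -addnn.
  by rewrite -addn1 leq_add2l.
exists u, M; split; first exact: ltW.
  rewrite natrM mulrCA; apply: (@le_trans _ _ (N%:R * r)).
    by rewrite ler_wpM2l// mulrC -ler_pdivlMr.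
  rewrite /r mulrCA ler_piMr ?(ltW eps0)// ler_pdivrMr// mul1r ler_nat//.
have M0 : 0 < M%:R :> R by rewrite ltr0n.
apply: lt_trans (_ : 2 / r * G u * M%:R < _); last by rewrite ltr_pM2r.
move: rM; rewrite ltr_pdivrMr// => rM.
have -> : 2 / r * G u * M%:R = (2 * M%:R * G u) / r by field; rewrite gt_eqF.
by rewrite ltr_pdivlMr// mul1r.
Qed.

End spread.

(** * Slices at a supporting line *)

Section unit_ball_modular.
Context d (T : measurableType d) (R : realType).
Variables (mu : {measure set T -> \bar R}) (phi : orliczFunction R).
Hypothesis phi_fin : finite_orlicz phi.
Local Notation G := (orlicz_real phi).

Lemma orlicz_real_normE u : phi `|u| = (G u)%:E.
Proof. by rewrite (orlicz_realE phi_fin)// orlicz_real_norm. Qed.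

(** The functions [c n * f] with [c n = 1 - 1 / (n + 1)] have norm below 1, hence modular at most 1.
    Continuity of [G] and monotone convergence carry the bound over to [f]. *)
Lemma norm_le1_modular (x : orliczSpace mu phi) f : represents x f -> `|x| <= 1 ->
  (modular mu phi f <= 1)%E.
Proof.
move=> xf x1; have [mf _ _] := xf.
pose c n : R := 1 - n.+1%:R^-1.
have c0 n : 0 <= c n by rewrite subr_ge0 invf_le1 ?ltr0n// ler1n.
have mc n : measurable_fun setT (fun t => c n * f t) by exact: measurable_funM.
have cle n : (modular mu phi (fun t => c n * f t)%R <= 1)%E.
  apply: (norm_lt_modular (representsZ (c n) xf) (lexx 1)).
  rewrite normrZ ger0_norm//; apply: le_lt_trans (ler_piMr (c0 n) x1) _.
  by rewrite /c gtrBl invr_gt0.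
have cv : modular mu phi (fun t => c n * f t)%R @[n --> \oo] -->
    (\int[mu]_t limn (fun n => phi `|c n * f t|%R))%E.
  apply: cvg_monotone_convergence => //.
  - by move=> n; exact: measurable_modular.
  - by move=> n t _; exact: orlicz_ge0.
  - move=> t _ n m nm; apply: orlicz_le => //.
    rewrite !normrM ler_wpM2r// !ger0_norm// lerD2l lerN2 lef_pV2 ?posrE//.
    by rewrite ler_nat.
have -> : modular mu phi f = (\int[mu]_t limn (fun n => phi `|c n * f t|%R))%E.
  apply: eq_integral => t _; apply/esym/cvg_lim => //.
  under eq_fun do rewrite orlicz_real_normE; rewrite orlicz_real_normE.
  apply: cvg_EFin; first by apply: nearW.
  have cf : c n * f t @[n --> \oo] --> f t.
    rewrite -[X in _ --> X]mul1r; apply: cvgMl.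
    rewrite -[X in _ --> X]subr0; apply: cvgB; first exact: cvg_cst.
    exact: cvg_harmonic.
  have cG : G (c n * f t) @[n --> \oo] --> G (f t).
    by apply: (cvg_comp _ _ cf); exact: orlicz_real_continuous.
  exact: cG.
rewrite -(cvg_lim _ cv)//; apply: lime_le; first by apply/cvg_ex; eexists; exact: cv.
exact: nearW.
Qed.

End unit_ball_modular.

(** A Bregman divergence: the height of [phi], extended evenly, above the line of slope [p] through
    its point at [u]. *)
Definition support_gap {R : realType} (phi : orliczFunction R) (u p v : R) : R :=
  orlicz_real phi v - orlicz_real phi u - p * (v - u).

Section supporting_line_slice.
Context d (T : measurableType d) (R : realType).
Variables (mu : {measure set T -> \bar R}) (phi : orliczFunction R).
Hypothesis phi_fin : finite_orlicz phi.
Local Notation G := (orlicz_real phi).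
Variables (A : set T) (mA : measurable A) (m : R) (muA : mu A = m%:E).
Variables (u p : R) (u0 : 0 < u) (p0 : 0 < p) (Gum : G u * m = 1).
Hypothesis support : forall v, 0 <= v -> G u + p * (v - u) <= G v.

Local Notation gap := (support_gap phi u p).

Let m0 : 0 < m.
Proof.
have Gu := orlicz_real_ge0 phi u; rewrite ltNge; apply/negP => m0.
by have := mulr_ge0_le0 Gu m0; rewrite Gum ler10.
Qed.

Let Afin : (mu A < +oo)%E. Proof. by rewrite muA ltry. Qed.

Let gap_ge0 v : 0 <= gap v.
Proof.
have := support (normr_ge0 v); rewrite orlicz_real_norm /support_gap.
have : p * v <= p * `|v| by rewrite ler_pM2l// ler_norm.
by lra.
Qed.

Let norm_le_orlicz v : `|v| <= p^-1 * G v + u.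
Proof.
rewrite -(ler_pM2l p0) mulrDr mulVKf ?gt_eqF//.
have := support (normr_ge0 v); rewrite orlicz_real_norm.
by have := orlicz_real_ge0 phi u; lra.
Qed.

Let integrable_orlicz f : measurable_fun setT f -> (modular mu phi f < +oo)%E ->
  mu.-integrable A (EFin \o (fun t => G (f t))).
Proof.
move=> mf fI; have := measurable_modular phi mf.
rewrite (_ : (fun t => phi `|f t|) = EFin \o (fun t => G (f t))); last first.
  by apply/funext => t; exact: orlicz_real_normE.
move=> mG; apply/integrableP; split; first exact: measurable_funTS.
apply: le_lt_trans fI; rewrite (modular_split _ _ mA mf).
rewrite (eq_integral (fun t => phi `|f t|)); last first.
  by move=> t _; rewrite orlicz_real_normE//= ger0_norm// orlicz_real_ge0.
by rewrite leeDl// modular_ge0.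
Qed.

Let integrable_cst (r : R) : mu.-integrable A (EFin \o cst r).
Proof.
apply: measurable_bounded_integrable => //.
by apply: bounded_cst.
Qed.

(** As the slope [p] is positive, the supporting line bounds [|v|] by [p^-1 * G v + u], and [A] has
    finite measure. *)
Lemma integrable_orlicz_class f : measurable_fun setT f -> finite_modular mu phi f ->
  mu.-integrable A (EFin \o f).
Proof.
move=> mf [l l0 lf].
have mlf : measurable_fun setT (fun t => l * f t) by exact: measurable_funM.
pose g t := l^-1 * (p^-1 * G (l * f t) + u).
have ig : mu.-integrable A (EFin \o g).
  rewrite (_ : EFin \o g =
    fun t => (l^-1)%:E * ((p^-1)%:E * (G (l * f t))%:E + u%:E))%E; last first.
    by apply/funext => t.
  apply: integrableZl => //; apply: integrableD => //; last exact: integrable_cst.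
  by apply: integrableZl => //; exact: integrable_orlicz.
apply: le_integrable ig => //.
  by apply/measurable_EFinP; exact: measurable_funTS.
move=> t _ /=; rewrite lee_fin; apply: le_trans (ler_norm _).
rewrite /g ler_pdivlMl//; apply: le_trans (norm_le_orlicz _).
by rewrite normrM gtr0_norm.
Qed.

Let integrableMl (c : R) f : mu.-integrable A (EFin \o f) ->
  mu.-integrable A (EFin \o (fun t => c * f t)).
Proof. by move=> if_; apply: (integrableZl mA c if_). Qed.

Let integrable_gap f : measurable_fun setT f -> (modular mu phi f < +oo)%E ->
  mu.-integrable A (EFin \o (fun t => gap (f t))).
Proof.
move=> mf fy; have iG := integrable_orlicz mf fy.
have ip := integrableMl p (integrable_orlicz_class mf (finite_modular_lty fy)).
have := integrableD mA (integrableB mA iG ip) (integrable_cst (p * u - G u)).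
by apply: eq_integrable => // t _; rewrite /= -EFinB -EFinD /support_gap; congr EFin; ring.
Qed.

Let integral_gap f : measurable_fun setT f -> (modular mu phi f <= 1)%E ->
  (modular mu phi f = (\int[mu]_(t in A) gap (f t) + 1 +
    p * (\int[mu]_(t in A) f t - u * m))%:E +
    modular mu phi (fun t => \1_(~` A) t * f t)%R)%E.
Proof.
move=> mf f1; have fy : (modular mu phi f < +oo)%E by apply: le_lt_trans f1 _; rewrite ltry.
rewrite (modular_split _ _ mA mf); congr (_ + _)%E.
have iG := integrable_orlicz mf fy.
have if_ : mu.-integrable A (EFin \o f).
  exact: (integrable_orlicz_class mf (finite_modular_lty fy)).
have ip := integrableMl p if_.
have igap : \int[mu]_(t in A) gap (f t) =
    \int[mu]_(t in A) G (f t) - p * \int[mu]_(t in A) f t + (p * u - G u) * m.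
  rewrite (@eq_Rintegral _ _ _ _ _ (fun t => (G (f t) - p * f t) + (p * u - G u))).
    have iD : mu.-integrable A (EFin \o (fun t => G (f t) - p * f t)).
      by apply: eq_integrable (integrableB mA iG ip).
    rewrite (RintegralD mA iD (integrable_cst _)).
    by rewrite RintegralB// RintegralZl// Rintegral_cst// muA.
  by move=> t _; rewrite /support_gap; ring.
rewrite (eq_integral (EFin \o (fun t => G (f t)))); last first.
  by move=> t _; rewrite orlicz_real_normE.
rewrite igap mulrBl Gum -[LHS]fineK; last exact: integrable_fin_num.
by congr EFin; rewrite -/(Rintegral mu A (fun t => G (f t))); ring.
Qed.

(** Since [G u * m = 1], integrating the gap turns [modular f <= 1] into a bound by 0 for the sum of
    [p * (I - u * m)], the integral of the gap over [A] and the modular off [A], where [I] is the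
    integral of [f] over [A]. The last two terms are nonnegative, hence small once [I] is close to
    [u * m]. *)
Lemma slice_estimate f e : measurable_fun setT f -> (modular mu phi f <= 1)%E ->
  u * m - e <= \int[mu]_(t in A) f t ->
  [/\ \int[mu]_(t in A) f t <= u * m, \int[mu]_(t in A) gap (f t) <= p * e &
    (modular mu phi (fun t => \1_(~` A) t * f t)%R <= (p * e)%:E)%E].
Proof.
move=> mf f1 fe; have := f1; rewrite integral_gap//.
set I := Rintegral _ _ f; set J := Rintegral _ _ _; set M := modular _ _ _.
have J0 : 0 <= J by apply: Rintegral_ge0.
have M0 : (0 <= M)%E := modular_ge0 _ _ _.
have ep : p * (u * m - I) <= p * e by rewrite ler_pM2l// lerBlDr -lerBlDl.
move: M0; case: M => [M|//|]; last by rewrite leNye.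
rewrite lee_fin -EFinD lee_fin => M0 JM.
have Ium : p * I <= p * (u * m) by move: JM J0 M0; lra.
split; [by rewrite -(ler_pM2l p0)|by move: JM M0 ep; lra|].
by rewrite lee_fin; move: JM J0 ep; lra.
Qed.

Fact integral_class_is_linear :
  linear (fun x : orliczSpace mu phi => \int[mu]_(t in A) (repr x : T -> R) t : R^o).
Proof.
move=> a x y.
have ix z : mu.-integrable A (EFin \o (repr z : orliczFun mu phi)).
  by apply: integrable_orlicz_class; [exact: orliczFun_measurable|exact: orliczFun_finite].
have xR := represents_repr x; have yR := represents_repr y.
have [mR _ eR] := representsD (representsZ a xR) yR.
transitivity (\int[mu]_(t in A) (a * (repr x : orliczFun mu phi) t +
    (repr y : orliczFun mu phi) t)).
  congr fine; apply: ae_eq_integral => //.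
  - apply/measurable_EFinP; apply: measurable_funTS; exact: orliczFun_measurable.
  - by apply/measurable_EFinP; apply: measurable_funTS.
  - by apply: filterS eR => t /= h _; rewrite h.
rewrite RintegralD//; last first.
  exact: integrableMl.
by rewrite RintegralZl.
Qed.

Lemma integral_dual_ex : exists g : dual (orliczSpace mu phi),
  forall x f, represents x f -> g x = \int[mu]_(t in A) f t.
Proof.
pose L := GRing.isLinear.Build _ _ _ _ _ integral_class_is_linear.
pose l : {linear orliczSpace mu phi -> R^o} :=
  HB.pack (fun x : orliczSpace mu phi => \int[mu]_(t in A) (repr x : T -> R) t : R^o) L.
have lE x f : represents x f -> l x = \int[mu]_(t in A) f t.
  move=> [mf hf xf]; congr fine; apply: ae_eq_integral => //.
  - apply/measurable_EFinP; apply: measurable_funTS; exact: orliczFun_measurable.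
  - by apply/measurable_EFinP; apply: measurable_funTS.
  - by apply: filterS xf => t /= h _; rewrite h.
have l1 x : `|x| <= 1 -> l x <= u * m.
  move=> x1; have xR := represents_repr x; rewrite (lE _ _ xR).
  have f1 := norm_le1_modular phi_fin xR x1; have [mf _ _] := xR.
  (* With the defect itself for [e] the lower bound is an equality, and the upper bound on the
     integral comes for free. *)
  have [|-> //] := @slice_estimate _
    (u * m - \int[mu]_(t in A) (repr x : orliczFun mu phi) t) mf f1.
  by rewrite subKr.
have lc : continuous l.
  apply: bounded_linear_continuous; apply/ex_bound; exists (u * m).
  apply/nbhs_ballP; exists 1 => //= x; rewrite -ball_normE/= sub0r normrN => /ltW x1.
  have := l1 (- x); rewrite linearN normrN => /(_ x1) lNx.
  by rewrite [X in is_true X]/= ler_norml lerNl lNx l1.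
by exists (Dual lc).
Qed.

(* Over the complement of [A] it suffices to bound norms of functions of small modular
   away from 1: when [phi] vanishes near 0 these norms need not be small. *)
Hypothesis outside : exists t h : R, [/\ 0 < t, 0 < h &
  forall f, measurable_fun setT f -> (modular mu phi f <= h%:E)%E ->
    (modular mu phi (fun x => (1 + t) * f x)%R <= 1)%E].

(** Over [A], closeness to the constant [u] in norm is required. On a non-atomic [A] it comes from
    the gap, on a single atom from the integral. *)
Hypothesis inside : forall l, 0 < l -> exists2 h : R, 0 < h &
  forall f, measurable_fun setT f -> mu.-integrable A (EFin \o (fun x => gap (f x))) ->
    \int[mu]_(x in A) gap (f x) <= h ->
    `|\int[mu]_(x in A) f x - u * m| <= h ->
    (modular mu phi (fun x => l * (\1_A x * (f x - u)))%R <= 1)%E.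

(** Write [x - c] with [c = u 1_A] as a part on [A] and a part off [A]. On the slice their norms are
    at most [l^-1] and [(1 + t)^-1], so the slice lies in a ball of radius [D < 1] about [c]. *)
Lemma supporting_line_not_LD2P : ~ LD2P (orliczSpace mu phi).
Proof.
move=> ld; have [t [h [t0 h0 out]]] := outside.
have t1 : 0 < 1 + t by rewrite ltr_wpDl.
(* Then [l^-1] is half of [1 - (1 + t)^-1]. *)
pose l := 2 * (1 + t) / t; have l0 : 0 < l by rewrite divr_gt0// mulr_gt0.
have [k k0 ins] := inside l0.
have [g gE] := integral_dual_ex.
have um0 : 0 < u * m by rewrite mulr_gt0.
have cE : modular mu phi (fun x => u * \1_A x)%R = 1%E.
  rewrite modular_cst_indic ?(ltW u0)// (orlicz_realE phi_fin) ?(ltW u0)//.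
  by rewrite muA -EFinM Gum.
have mc : measurable_fun setT (fun x => u * \1_A x : R).
  by apply: measurable_funM => //; exact: measurable_indic.
have [c cR] : exists c : orliczSpace mu phi, represents c (fun x => u * \1_A x).
  by apply: represents_ex => //; apply: finite_modular_lty; rewrite cE ltry.
have c1 : unit_ball c by apply: (modular_le1_norm cR); rewrite cE.
have gc : g c = u * m.
  rewrite (gE _ _ cR) (@eq_Rintegral _ _ _ _ _ (fun=> u)).
    by rewrite Rintegral_cst// muA.
  by move=> x; rewrite inE => Ax; rewrite indicE mem_set// mulr1.
have est x e : unit_ball x -> u * m - e <= g x ->
    [/\ \int[mu]_(y in A) (repr x : orliczFun mu phi) y <= u * m,
    \int[mu]_(y in A) gap ((repr x : orliczFun mu phi) y) <= p * e &
    (modular mu phi (fun y => \1_(~` A) y * (repr x : orliczFun mu phi) y)%R <= (p * e)%:E)%E].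
  move=> x1; have xR := represents_repr x; rewrite (gE _ _ xR) => xe.
  by apply: slice_estimate => //; exact: (norm_le1_modular phi_fin xR).
have gn : dual_norm g = u * m.
  apply/eqP; rewrite eq_le -[X in _ && (X <= _)]gc unit_ball_dual_le// andbT.
  apply/ler_addgt0Pr => e e0; have [x x1 gx] := dual_norm_approx g e0.
  rewrite -lerBlDr; apply: le_trans (ltW gx) _; rewrite (gE _ _ (represents_repr x)).
  by have [] := est x (u * m - g x) x1; rewrite ?subKr.
pose e := Num.min k (Num.min (k / p) (h / p)).
have e0 : 0 < e by rewrite !lt_min k0 !divr_gt0.
have ek : e <= k by rewrite ge_min lexx.
have pek : p * e <= k by rewrite mulrC -ler_pdivlMr// !ge_min lexx orbT.
have peh : p * e <= h by rewrite mulrC -ler_pdivlMr// !ge_min lexx !orbT.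
have gn0 : dual_norm g != 0 by rewrite gn gt_eqF.
have /ld dS := slice_of_functional gn0 e0.
pose D := l^-1 + (1 + t)^-1.
have D1 : D < 1.
  rewrite (_ : D = 1 - t / (2 * (1 + t))).
    by rewrite ltrBlDr ltrDl divr_gt0// mulr_gt0.
  by rewrite /D /l; field; rewrite !gt_eqF.
have close x : unit_ball x -> dual_norm g - e < g x -> `|x - c| <= D.
  move=> x1; rewrite gn => /ltW gx; have xR := represents_repr x.
  have [xu xgap xout] := est x e x1 gx.
  pose f : T -> R := (repr x : orliczFun mu phi).
  have mf : measurable_fun setT f by exact: orliczFun_measurable.
  have mCA : measurable (~` A) by exact: measurableC.
  have mCf : measurable_fun setT (fun y => \1_(~` A) y * f y) by exact: measurable_indicM.
  have [b bR] : exists b : orliczSpace mu phi, represents b (fun y => \1_(~` A) y * f y).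
    apply: represents_ex => //; apply: finite_modular_lty.
    by apply: le_lt_trans xout _; rewrite ltry.
  have aR := representsB (representsB xR cR) bR.
  rewrite -(subrK b (x - c)); apply: le_trans (ler_normD _ _) _; apply: lerD.
    apply: (modular_scale_le1_norm aR l0).
    rewrite (@modular_norm _ _ _ _ _ _ (fun y => l * (\1_A y * (f y - u)))); last first.
      move=> y; congr `|_|; congr (_ * _); rewrite -/f !indicE in_setC.
      by case: (y \in A) => /=; ring.
    apply: ins => //.
    - apply: integrable_gap => //.
      by apply: le_lt_trans (norm_le1_modular phi_fin xR x1) _; rewrite ltry.
    - exact: le_trans xgap pek.
    - rewrite ler0_norm ?subr_le0// opprB -(gE _ _ xR); move: gx ek; lra.
  apply: (modular_scale_le1_norm bR t1); apply: out => //.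
  by apply: le_trans xout _; rewrite lee_fin.
pose S := unit_ball `&` [set x | dual_norm g - e < g x].
have : (diam S <= (D + D)%:E)%E.
  apply: ge_ereal_sup => _ [[x y] [/= [x1 gx] [y1 gy]] <-].
  rewrite lee_fin -(subrKA c); apply: le_trans (ler_normD _ _) _.
  by rewrite (distrC c); apply: lerD; exact: close.
by rewrite [diam S]dS lee_fin; lra.
Qed.

End supporting_line_slice.

(** * Exposed points *)

Section exposed_points.
Context {R : realType} (phi : orliczFunction R) (phi_fin : finite_orlicz phi).
Local Notation G := (orlicz_real phi).

(** The slope is the supremum of the chord slopes to the left of [u]. Convexity puts it below all
    chord slopes to the right, and the chord from 0 makes it positive. *)
Lemma supporting_line_ex u : 0 < u -> 0 < G u -> exists2 p, 0 < p &
  forall v, 0 <= v -> G u + p * (v - u) <= G v.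
Proof.
move=> u0 Gu.
pose S := [set (G u - G v) / (u - v) | v in [set v : R | 0 <= v < u]].
have chord v w : 0 <= v < u -> u < w -> (G u - G v) / (u - v) <= (G w - G u) / (w - u).
  move=> /andP[v0 vu] uw; have uv0 : 0 < u - v by rewrite subr_gt0.
  have wu0 : 0 < w - u by rewrite subr_gt0.
  rewrite ler_pdivrMr// mulrAC ler_pdivlMr//.
  have vuw : v <= u <= w by rewrite !ltW.
  have := orlicz_real_chord phi_fin v0 vuw (lt_trans vu uw).
  by lra.
have S0 : has_sup S.
  split; first by exists ((G u - G 0) / (u - 0)), 0 => //=; rewrite lexx.
  exists ((G (2 * u) - G u) / (2 * u - u)) => _ [v vu <-]; apply: chord => //; lra.
exists (sup S).
  apply: (@lt_le_trans _ _ ((G u - G 0) / (u - 0))).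
    by rewrite (orlicz_real0 phi) !subr0 divr_gt0.
  by apply: ub_le_sup; [case: S0|exists 0 => //=; rewrite lexx].
move=> v v0; have [vu|uv|->] := ltgtP v u; last by rewrite subrr mulr0 addr0.
- have : (G u - G v) / (u - v) <= sup S.
    by apply: ub_le_sup; [case: S0|exists v => //=; rewrite v0].
  by rewrite ler_pdivrMr ?subr_gt0//; lra.
- have : sup S <= (G v - G u) / (v - u).
    by apply: ge_sup => [|_ [w wu <-]]; [case: S0|exact: chord].
  by rewrite ler_pdivlMr ?subr_gt0//; lra.
Qed.

Lemma N_function_superlinear M : N_function_at_infinity phi ->
  exists2 B, 0 < B & forall v, B <= v -> M * v <= G v.
Proof.
move=> /cvgeyPge/(_ M)[B [_ BM]].
exists (Num.max 1 (B + 1)); first by rewrite lt_max ltr01.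
move=> v; rewrite ge_max => /andP[v1 Bv].
have v0 : 0 < v by rewrite (lt_le_trans ltr01).
have /BM : B < v by apply: lt_le_trans Bv; rewrite ltrDl.
by rewrite /= (orlicz_realE phi_fin) ?(ltW v0)// -EFinM lee_fin ler_pdivlMr.
Qed.

(* Minimise [phi - q] with [q v = s v + 1 / (1 + v)]: as [q] is strictly convex, the
   minimiser [u] is an exposed point, and the slope [s] pushes [u] beyond [u0]. *)
Lemma exposed_point_ex u0 : 0 < u0 -> N_function_at_infinity phi ->
  exists u p, [/\ u0 <= u, 0 < p & forall v, 0 <= v ->
    (v - u) ^+ 2 / ((1 + v) * (1 + u) ^+ 2) <= support_gap phi u p v].
Proof.
(* [L] bounds the slopes of [G] on [[0, u0]], and [1 / (1 + v)] falls at rate at most 1. With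
   [s = L + 2], [H] is thus larger at every point below [u0] than at [u0]. *)
move=> u00 nf; pose L := G (2 * u0) / u0; pose s := L + 2.
have L0 : 0 <= L by rewrite divr_ge0 ?orlicz_real_ge0// ltW.
(* Beyond [B0] the extra 1 gives [H v >= v - 1 >= H 0], so a minimiser on a compact interval is a
   minimiser on the half-line. *)
have [B0 B00 BG] := N_function_superlinear (s + 1) nf.
pose B := Num.max u0 B0.
have B_gt0 : 0 < B by rewrite lt_max u00.
pose q v : R := s * v + (1 + `|v|)^-1; pose H v := G v - q v.
have n1 (v : R) : 0 < 1 + `|v| by rewrite ltr_pwDl.
have cH : continuous H.
  move=> v; apply: cvgB; first exact: orlicz_real_continuous.
  apply: cvgD; first by apply: cvgMr; exact: cvg_id.
  apply: cvgV; first by rewrite gt_eqF.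
  by apply: cvgD; [exact: cvg_cst|apply: cvg_norm; exact: cvg_id].
have [u] := EVT_min (ltW B_gt0) (continuous_subspaceT cH).
rewrite in_itv/= => /andP[u_ge0 uB] umin.
have Hmin v : 0 <= v -> H u <= H v.
  move=> v0; have [vB|Bv] := leP v B; first by apply: umin; rewrite in_itv/= v0.
  apply: le_trans (umin 0 _) _; first by rewrite in_itv/= lexx ltW.
  have := BG v; rewrite (le_trans _ (ltW Bv)) ?le_max ?lexx ?orbT// => /(_ isT).
  rewrite /H /q (orlicz_real0 phi) mulr0 normr0 addr0 invr1 !add0r.
  have : (1 + `|v|)^-1 <= 1 by rewrite invf_le1// lerDl.
  by lra.
have u0u : u0 <= u.
  rewrite leNgt; apply/negP => uu0; have := Hmin u0 (ltW u00).
  rewrite /H /q !ger0_norm ?(ltW u00)//.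
  have := @orlicz_real_lipschitz _ phi phi_fin u u0 u0 u_ge0.
  rewrite (ltW uu0) lexx => /(_ isT u00); rewrite -/L => lip.
  have : (1 + u)^-1 - (1 + u0)^-1 <= u0 - u.
    have a1 : 0 < 1 + u by rewrite ltr_pwDl.
    have b1 : 0 < 1 + u0 by rewrite ltr_pwDl// ltW.
    have -> : (1 + u)^-1 - (1 + u0)^-1 = (u0 - u) / ((1 + u) * (1 + u0)).
      by field; rewrite !gt_eqF.
    rewrite ler_pdivrMr ?mulr_gt0// ler_peMr ?subr_ge0 ?(ltW uu0)//.
    by have := mulr_ge0 u_ge0 (ltW u00); lra.
  by move: lip uu0; rewrite /s; lra.
have a1 : 0 < 1 + u by rewrite ltr_pwDl.
(* The slope is the derivative of [q] at [u]. The lower bound for the gap is the distance of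
   [1 / (1 + v)] from its tangent at [u]. *)
exists u, (s - (1 + u) ^- 2); split => //.
  have : (1 + u) ^- 2 <= 1 by rewrite invf_le1 ?exprn_gt0// exprn_ege1// lerDl.
  by rewrite /s; lra.
move=> v v0; have := Hmin v v0; rewrite /H /q !ger0_norm//.
have b1 : 0 < 1 + v by rewrite ltr_pwDl.
have -> : (v - u) ^+ 2 / ((1 + v) * (1 + u) ^+ 2) =
    (1 + v)^-1 - (1 + u)^-1 + (1 + u) ^- 2 * (v - u).
  by field; rewrite !gt_eqF.
by rewrite /support_gap; lra.
Qed.

Section doubling.
Variables (K c : R) (K0 : 0 <= K) (c0 : 0 <= c).
Hypothesis doubling : forall v, 0 <= v -> G (2 * v) <= K * G v + c.

Lemma doubling_dilate l : 0 <= l -> exists a b, [/\ 0 <= a, 0 <= b &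
  forall v, 0 <= v -> G (l * v) <= a * G v + b].
Proof.
move=> l0; have [k lk] := expr_unbounded l (ltr1n R 2).
have [a [b [a0 b0 kab]]] : exists a b, [/\ 0 <= a, 0 <= b &
    forall v, 0 <= v -> G (2 ^+ k * v) <= a * G v + b].
  elim: k {lk} => [|k [a [b [a0 b0 kab]]]].
    by exists 1, 0; split => // v v0; rewrite expr0 !mul1r addr0.
  exists (a * K), (a * c + b); split; rewrite ?addr_ge0 ?mulr_ge0// => v v0.
  rewrite exprSr -mulrA; apply: le_trans (kab _ _) _; first by rewrite mulr_ge0.
  have := ler_wpM2l a0 (doubling v0); lra.
exists a, b; split => // v v0; apply: le_trans (kab v v0).
by rewrite orlicz_real_le ?mulr_ge0// ler_wpM2r.
Qed.

(** Near [u] the left side is at most [e]. Away from [u] the gap dominates [1 + |v|], hence also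
    [G v], which exceeds it by an affine function only; doubling then takes care of the dilation by
    [l]. *)
Lemma doubling_gap_bound u p l e : 0 < u -> 0 < p -> 0 < l -> 0 < e ->
  (forall v, 0 <= v ->
    (v - u) ^+ 2 / ((1 + v) * (1 + u) ^+ 2) <= support_gap phi u p v) ->
  exists2 C, 0 <= C & forall v, G (l * (v - u)) <= e + C * support_gap phi u p v.
Proof.
move=> u0 p0 l0 e0 gapE; have Gl0 := orlicz_real_ge0 phi l.
have a1 : 0 < 1 + u by rewrite ltr_pwDl// ltW.
pose r := Num.min 1 (e / (1 + G l)).
have r0 : 0 < r by rewrite lt_min ltr01 divr_gt0// ltr_pwDl.
have near v : `|v - u| <= r -> G (l * (v - u)) <= e.
  move=> vr; rewrite -orlicz_real_norm normrM (gtr0_norm l0).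
  apply: (@le_trans _ _ (G (r * l))).
    by rewrite orlicz_real_le ?mulr_ge0 ?(ltW l0)// mulrC ler_pM2r.
  have r01 : 0 <= r <= 1 by rewrite (ltW r0) ge_min lexx.
  apply: le_trans (orlicz_real_scale phi_fin r01 (ltW l0)) _.
  apply: (@le_trans _ _ (r * (1 + G l))); first by rewrite ler_pM2l// lerDr.
  by rewrite -ler_pdivlMr ?ltr_pwDl// ge_min lexx orbT.
(* The gap is also needed at negative [v], where evenness of [G] adds [p * |v|] to the bound at
   0. *)
have gap_neg v : v < 0 -> p * `|v| + u ^+ 2 / (1 + u) ^+ 2 <= support_gap phi u p v.
  move=> v0; have := gapE 0 (lexx 0); rewrite /support_gap (orlicz_real0 phi) sub0r sqrrN.
  rewrite addr0 mul1r -(orlicz_real_norm phi v) ltr0_norm//.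
  by have := orlicz_real_ge0 phi (- v); lra.
have gap0 v : 0 <= support_gap phi u p v.
  have [v0|v0] := leP 0 v.
    by apply: le_trans (gapE v v0); rewrite divr_ge0 ?sqr_ge0// mulr_ge0 ?sqr_ge0// addr_ge0.
  apply: le_trans (gap_neg v v0); rewrite addr_ge0 ?divr_ge0 ?sqr_ge0//.
  by rewrite mulr_ge0// ltW.
have [C1 C10 far] : exists2 C1, 0 <= C1 &
    forall v, r <= `|v - u| -> 1 + `|v| <= C1 * support_gap phi u p v.
  pose k := (1 + u) / r + 1; pose C' := (k * (1 + u)) ^+ 2.
  pose s := Num.min p (u ^+ 2 / (1 + u) ^+ 2).
  have s0 : 0 < s by rewrite lt_min p0 divr_gt0// exprn_gt0.
  have k0 : 0 < k by rewrite ltr_pwDr// divr_ge0 ?(ltW a1) ?(ltW r0).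
  exists (C' + s^-1); first by rewrite addr_ge0 ?sqr_ge0// invr_ge0 ltW.
  move=> v vr; rewrite mulrDl; have [v0|v0] := leP 0 v.
    have b1 : 0 < 1 + v by rewrite ltr_pwDl.
    apply: (@le_trans _ _ (C' * support_gap phi u p v)); last first.
      by rewrite lerDl mulr_ge0// invr_ge0 ltW.
    have vk : 1 + v <= k * `|v - u|.
      have : 1 + u <= (1 + u) / r * `|v - u|.
        by rewrite mulrAC ler_pdivlMr// ler_pM2l.
      have := ler_norm (v - u); rewrite /k; lra.
    have vk2 : (1 + v) ^+ 2 <= k ^+ 2 * (v - u) ^+ 2.
      rewrite -[(v - u) ^+ 2]real_normK ?num_real// -exprMn.
      by rewrite ler_sqr ?nnegrE ?mulr_ge0 ?(ltW k0) ?(ltW b1).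
    rewrite (ger0_norm v0); apply: le_trans (ler_wpM2l (sqr_ge0 _) (gapE v v0)).
    rewrite mulrA ler_pdivlMr ?mulr_gt0 ?exprn_gt0//.
    have := ler_wpM2r (sqr_ge0 (1 + u)) vk2; lra.
  apply: (@le_trans _ _ (s^-1 * support_gap phi u p v)); last first.
    by rewrite lerDr mulr_ge0// sqr_ge0.
  rewrite ler_pdivlMl//; apply: le_trans (gap_neg v v0).
  rewrite mulrDr mulr1 addrC; apply: lerD.
    by rewrite ler_wpM2r// ge_min lexx.
  by rewrite ge_min lexx orbT.
have [a [b [a0 b0 lab]]] := doubling_dilate (mulr_ge0 (ler0n R 2) (ltW l0)).
pose b' := b + G (2 * l * u).
have b'0 : 0 <= b' by rewrite addr_ge0// orlicz_real_ge0.
have dil v : G (l * (v - u)) <= a * G v + b'.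
  rewrite -orlicz_real_norm normrM (gtr0_norm l0).
  apply: (@le_trans _ _ (G (2^-1 * (2 * l * `|v|) + (1 - 2^-1) * (2 * l * u)))).
    rewrite orlicz_real_le ?mulr_ge0 ?(ltW l0)//.
    rewrite (_ : 2^-1 * _ + _ = l * (`|v| + u)); last by field.
    rewrite ler_pM2l//; apply: le_trans (ler_normB _ _) _.
    by rewrite (gtr0_norm u0).
  apply: le_trans (orlicz_real_convex phi_fin _ _ _) _.
  - by apply/andP; split; lra.
  - by rewrite !mulr_ge0// ltW.
  - by rewrite !mulr_ge0// ltW.
  have := lab _ (normr_ge0 v); rewrite [G `|v|]orlicz_real_norm /b'.
  have := orlicz_real_ge0 phi (2 * l * `|v|); have := orlicz_real_ge0 phi (2 * l * u).
  lra.
pose D := (G u + p) * C1.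
have Gu0 := orlicz_real_ge0 phi u.
have D0 : 0 <= D by rewrite mulr_ge0// addr_ge0// ltW.
exists (a * (1 + D) + b' * C1).
  by rewrite addr_ge0 ?mulr_ge0// addr_ge0.
move=> v; have g0 := gap0 v; have [vr|/ltW vr] := leP `|v - u| r.
  apply: le_trans (near v vr) _; rewrite lerDl mulr_ge0//.
  by rewrite addr_ge0 ?mulr_ge0// addr_ge0.
have fv := far v vr.
have Gv : G v <= (1 + D) * support_gap phi u p v.
  have : G v <= support_gap phi u p v + (G u + p) * (1 + `|v|).
    rewrite /support_gap; have pv : p * v <= p * `|v| by rewrite ler_pM2l// ler_norm.
    have := mulr_ge0 Gu0 (normr_ge0 v); have := mulr_gt0 p0 u0; lra.
  have := ler_wpM2l (addr_ge0 Gu0 (ltW p0)) fv; rewrite /D; lra.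
apply: le_trans (dil v) _; apply: (@le_trans _ _ (a * ((1 + D) * support_gap phi u p v) +
   b' * (C1 * support_gap phi u p v))).
  apply: lerD; first by rewrite ler_wpM2l.
  rewrite -[X in X <= _]mulr1 ler_wpM2l//; apply: le_trans fv; rewrite lerDl//.
by rewrite !mulrA -mulrDl lerDr ltW.
Qed.

End doubling.

End exposed_points.

(** * Doubling Orlicz functions *)

Section nonatomic_slice.
Context d (T : measurableType d) (R : realType).
Variables (mu : {measure set T -> \bar R}) (phi : orliczFunction R).
Hypothesis phi_fin : finite_orlicz phi.
Hypotheses (mu_sf : sigma_finite setT mu) (mu_gt0 : (0 < mu setT)%E).
Hypothesis mu_na : nonatomic mu.
Local Notation G := (orlicz_real phi).

(** A common form of both conditions: the constant [c] absorbs the range below [u0], and is 0 when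
    the measure is infinite, so that [c] has a finite integral. *)
Let Delta2_doubling : Delta2_nonatomic phi mu -> exists K c C : R,
  [/\ 0 <= K, 0 <= c, 0 <= C, (c%:E * mu setT <= C%:E)%E &
    forall v, 0 <= v -> G (2 * v) <= K * G v + c].
Proof.
have GE := orlicz_realE phi_fin.
rewrite /Delta2_nonatomic; case: ifPn => [_ [K K2 H]|muT [K [u0 [K2 u00 _ H]]]].
  have K0 : 0 <= K by rewrite ltW// (lt_trans _ K2).
  exists K, 0, 0; split; rewrite ?mul0e// => v v0; rewrite addr0.
  by have := H v v0; rewrite !GE ?mulr_ge0// -EFinM lee_fin.
have K0 : 0 <= K by rewrite ltW// (lt_trans _ K2).
have c0 := orlicz_real_ge0 phi (2 * u0).
have muE : mu setT = (fine (mu setT))%:E by rewrite fineK// ge0_fin_numE// ltey.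
exists K, (G (2 * u0)), (G (2 * u0) * fine (mu setT)); split => //.
- by rewrite mulr_ge0// fine_ge0.
- by rewrite muE.
- move=> v v0; have [uv|/ltW vu] := leP u0 v.
    have := H v uv; rewrite !GE ?mulr_ge0// -EFinM lee_fin => /le_trans; apply.
    by rewrite lerDl.
  have : G (2 * v) <= G (2 * u0) by rewrite orlicz_real_le ?mulr_ge0// ler_pM2l.
  by move=> /le_trans; apply; rewrite lerDr mulr_ge0// orlicz_real_ge0.
Qed.

Lemma nonatomic_Delta2_not_LD2P : N_function_at_infinity phi ->
  Delta2_nonatomic phi mu -> ~ LD2P (orliczSpace mu phi).
Proof.
move=> nf /Delta2_doubling[K [c [C [K0 c0 C0 cC dbl]]]].
have [r r0 rmu] : exists2 r, 0 < r & (r%:E <= mu setT)%E.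
  have [muT|muT] := eqVneq (mu setT) +oo%E; first by exists 1 => //; rewrite muT leey.
  have muE : mu setT = (fine (mu setT))%:E by rewrite fineK// ge0_fin_numE// ltey.
  by exists (fine (mu setT)); rewrite -?muE// -lte_fin -muE.
(* The exposed point is taken so far out that [1 / G u] does not exceed the measure of the space, as
   [A] must have this measure. *)
have [u1 u10 u1G] := orlicz_real_unbounded phi_fin r^-1.
have [u [p [u1u p0 gapE]]] := exposed_point_ex phi_fin u10 nf.
have u0 : 0 < u := lt_le_trans u10 u1u.
have rG : r^-1 <= G u by apply: le_trans u1G _; apply: orlicz_real_le => //; exact: ltW.
have Gu : 0 < G u by apply: lt_le_trans rG; rewrite invr_gt0.
pose m := (G u)^-1; have m0 : 0 < m by rewrite invr_gt0.
have mr : m <= r by rewrite -[r]invrK lef_pV2 ?posrE// invr_gt0.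
have [A [mA muA]] : exists A, measurable A /\ mu A = m%:E.
  have mmu : (m%:E <= mu setT)%E by apply: le_trans rmu; rewrite lee_fin.
  have [B [mB Bfin mB']] : exists B, [/\ measurable B, (mu B < +oo)%E & (m%:E <= mu B)%E].
    have [muT|muT] := eqVneq (mu setT) +oo%E.
      by apply: sigma_finite_large_subset; rewrite // muT ltry.
    by exists setT; split => //; rewrite ltey.
  have [A [mA _ muA]] := nonatomic_subset_measure mu_na mB Bfin (ltW m0) mB'.
  by exists A.
have sup v : 0 <= v -> G u + p * (v - u) <= G v.
  move=> v0; have : 0 <= support_gap phi u p v.
    apply: le_trans (gapE v v0); rewrite divr_ge0 ?sqr_ge0// mulr_ge0 ?sqr_ge0//.
    by rewrite addr_ge0.
  by rewrite /support_gap; lra.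
apply: (@supporting_line_not_LD2P _ _ _ mu phi phi_fin A mA m muA u p u0 p0 _ sup).
- by rewrite /m divff// gt_eqF.
(* As [(1 + t) * v] is the combination of [2 * v] and [v] with weights [t] and [1 - t], a modular of
   at most [1 / 4] becomes at most [(1 + t * K) / 4 + t * C], which this [t] keeps below 1. *)
- pose t := (1 + K + 2 * C)^-1.
  have q0 : 0 < 1 + K + 2 * C by rewrite -addrA ltr_pwDl// addr_ge0// mulr_ge0.
  have t0 : 0 < t by rewrite invr_gt0.
  have tq : t * (1 + K + 2 * C) = 1 by rewrite mulVf// gt_eqF.
  have [tK tC] : 0 <= t * K /\ 0 <= t * C by rewrite !mulr_ge0// ltW.
  have tKC : t + t * K + 2 * (t * C) = 1 by move: tq; rewrite !mulrDr; lra.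
  exists t, (1 / 4); split => // f mf f4.
  have mG := measurable_modular phi mf.
  have tc0 : 0 <= t * c by rewrite mulr_ge0// ltW.
  have tK0 : 0 <= 1 + t * K by rewrite addr_ge0.
  apply: (@le_trans _ _ (\int[mu]_x ((1 + t * K)%:E * phi `|f x|%R + (t * c)%:E))%E).
    apply: ge0_le_integral => //.
    - by move=> x _; exact: orlicz_ge0.
    - by apply: measurable_modular; exact: measurable_funM.
    - by apply: emeasurable_funD => //; exact: measurable_funeM.
    - move=> x _; rewrite !(orlicz_real_normE phi_fin) -EFinM -EFinD lee_fin.
      rewrite -orlicz_real_norm normrM -(orlicz_real_norm phi (f x)).
      move: `|f x| (normr_ge0 (f x)) => v v0.
      rewrite ger0_norm ?addr_ge0 ?(ltW t0)//.
      have t01 : 0 <= t <= 1 by rewrite (ltW t0)/=; lra.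
      have := orlicz_real_convex phi_fin t01 (mulr_ge0 (ler0n R 2) v0) v0.
      rewrite (_ : t * (2 * v) + _ = (1 + t) * v); last by ring.
      move=> /le_trans; apply.
      have := ler_wpM2l (ltW t0) (dbl v v0).
      have := mulr_ge0 (ltW t0) (orlicz_real_ge0 phi v); lra.
  rewrite ge0_integralD//; last 2 first.
  - by move=> x _; rewrite mule_ge0 ?lee_fin// orlicz_ge0.
  - exact: measurable_funeM.
  rewrite ge0_integralZl_EFin//; last by move=> x _; exact: orlicz_ge0.
  rewrite integral_cst// EFinM -muleA.
  apply: (@le_trans _ _ ((1 + t * K)%:E * (1 / 4)%:E + t%:E * C%:E)%E).
    by apply: leeD; apply: lee_wpmul2l => //; rewrite lee_fin// ltW.
  by rewrite -!EFinM -EFinD lee_fin; lra.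
(* The constant [(2 * m)^-1] integrates to one half over [A]; the bound on the gap is chosen to
   contribute at most another half. *)
- move=> l l0; have e0 : 0 < (2 * m)^-1 by rewrite invr_gt0 mulr_gt0.
  have [D D0 HD] := doubling_gap_bound phi_fin K0 c0 dbl u0 p0 l0 e0 gapE.
  have D1 : 0 < D + 1 by rewrite ltr_wpDl.
  exists (2 * (D + 1))^-1; first by rewrite invr_gt0 mulr_gt0.
  move=> f mf igap gaph _.
  have mfu : measurable_fun setT (fun x => l * (f x - u)).
    by apply: measurable_funM => //; exact: measurable_funB.
  rewrite (@modular_norm _ _ _ _ _ _ (fun x => \1_A x * (l * (f x - u)))); last first.
    by move=> x; rewrite mulrCA.
  rewrite (modular_indicM mu phi (fun x => l * (f x - u)) mA).
  have iD : mu.-integrable A (EFin \o (fun x => D * support_gap phi u p (f x))).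
    exact: (integrableZl mA D igap).
  have ie : mu.-integrable A (EFin \o cst (2 * m)^-1).
    apply: measurable_bounded_integrable => //; first by rewrite muA ltry.
    exact: bounded_cst.
  have iS : mu.-integrable A (EFin \o (fun x => (2 * m)^-1 + D * support_gap phi u p (f x))).
    by apply: eq_integrable (integrableD mA ie iD).
  apply: (@le_trans _ _ (\int[mu]_(x in A) ((2 * m)^-1 + D * support_gap phi u p (f x))%:E)%E).
    apply: ge0_le_integral => //.
    - by move=> x _; exact: orlicz_ge0.
    - by apply: measurable_funTS; exact: measurable_modular.
    - exact: (measurable_int mu iS).
    - by move=> x _; rewrite (orlicz_real_normE phi_fin) lee_fin.
  rewrite -[leLHS]fineK ?integrable_fin_num// lee_fin.
  rewrite [leLHS](RintegralD mA ie iD) Rintegral_cst// muA RintegralZl//=.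
  apply: (@le_trans _ _ (2^-1 + (D + 1) * (2 * (D + 1))^-1)).
    apply: lerD; first by rewrite invfM divfK// gt_eqF.
    apply: (@le_trans _ _ (D * (2 * (D + 1))^-1)); first exact: ler_wpM2l.
    by rewrite ler_pM2r ?invr_gt0 ?mulr_gt0// lerDl.
  rewrite invfM mulrCA divff ?gt_eqF// mulr1; lra.
Qed.

End nonatomic_slice.

(** * The sequence space under the doubling condition at zero *)

Section counting_slice.
Context {R : realType} (phi : orliczFunction R) (phi_fin : finite_orlicz phi).
Local Notation G := (orlicz_real phi).
Local Notation mu := (@counting nat R : {measure set nat -> \bar R}).

Let mu1 (n : nat) : mu [set n] = 1%:E.
Proof.
rewrite /= /counting asboolT; last exact: finite_set1.
by rewrite fset_set1 cardfs1.
Qed.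

Let integral_singleton n (F : nat -> \bar R) : (\int[mu]_(x in [set n]) F x = F n)%E.
Proof.
rewrite (eq_integral (cst (F n))).
  by rewrite integral_cst// [X in (_ * X)%E]mu1 mule1.
by move=> x; rewrite inE => ->.
Qed.

Lemma counting_Delta2_not_LD2P : Delta2_zero phi -> ~ LD2P (orliczSpace mu phi).
Proof.
have GE := orlicz_realE phi_fin.
move=> [K [b [K2 b0 /andP[pb _] H]]].
have K0 : 0 < K by rewrite (lt_trans _ K2).
have Gb : 0 < G b by rewrite -lte_fin -GE.
have [u u0 Gu] : exists2 u, 0 < u & G u = 1.
  have [w w0 Gw] := orlicz_real_unbounded phi_fin 1.
  have cG : {within `[0, w], continuous G}.
    by apply: continuous_subspaceT; exact: orlicz_real_continuous.
  have := @IVT R G 0 w 1 (ltW w0) cG.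
  rewrite (orlicz_real0 phi) ge_min ler01 le_max Gw orbT => /(_ isT)[u].
  rewrite in_itv/= => /andP[u0 _] Gu; exists u => //.
  rewrite lt_neqAle u0 andbT eq_sym; apply/eqP => u0'.
  by move: Gu; rewrite u0' (orlicz_real0 phi) => /eqP; rewrite eq_sym oner_eq0.
have Gu0 : 0 < G u by rewrite Gu.
have [p p0 sup] := supporting_line_ex phi_fin u0 Gu0.
apply: (@supporting_line_not_LD2P _ _ _ mu phi phi_fin [set 0%N] _ 1 (mu1 0) u p u0 p0 _ sup).
- by [].
- by rewrite Gu mulr1.
(* A modular below [G b] confines all values to the range [[0, b]] where doubling holds; the bound
   [K^-1] then lets even [2 * f] have modular at most 1, so [t = 1]. *)
- pose h := Num.min (G b / 2) K^-1.
  have h0 : 0 < h by rewrite lt_min divr_gt0//= invr_gt0.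
  exists 1, h; split => // f mf fh.
  have small n : `|f n| <= b.
    rewrite leNgt; apply/negP => bf.
    have : (phi `|f n|%R <= h%:E)%E.
      apply: le_trans fh; rewrite (modular_split _ _ (_ : measurable [set n]) mf)//.
      by rewrite integral_singleton leeDl// modular_ge0.
    rewrite (orlicz_real_normE phi_fin) lee_fin leNgt => /negP; apply.
    apply: (@lt_le_trans _ _ (G b)); last first.
      by rewrite -(orlicz_real_norm phi (f n)) orlicz_real_le// ltW.
    have : h <= G b / 2 by rewrite ge_min lexx.
    by lra.
  apply: (@le_trans _ _ (\int[mu]_x (K%:E * phi `|f x|%R))%E).
    apply: ge0_le_integral => //.
    - by move=> x _; exact: orlicz_ge0.
    - move=> x _; rewrite normrM ger0_norm// (_ : 1 + 1 = 2)//.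
      by apply: H; rewrite normr_ge0 small.
  rewrite ge0_integralZl_EFin//; last 2 first.
  - by move=> x _; exact: orlicz_ge0.
  - exact: ltW.
  apply: (@le_trans _ _ (K%:E * h%:E)%E).
    by apply: lee_wpmul2l => //; rewrite lee_fin ltW.
  by rewrite -EFinM lee_fin mulrC -ler_pdivlMr// mul1r ge_min lexx orbT.
- move=> l l0; exists (u / l); first by rewrite divr_gt0.
  move=> f mf _ _; rewrite /Rintegral integral_singleton mulr1/= => fu.
  rewrite (@modular_norm _ _ _ _ _ _ (fun x => \1_[set 0%N] x * (l * (f x - u)))); last first.
    by move=> x; rewrite mulrCA.
  rewrite (@modular_indicM _ _ _ mu phi (fun x => l * (f x - u)) [set 0%N])//.
  rewrite integral_singleton (orlicz_real_normE phi_fin) lee_fin -Gu.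
  rewrite -(orlicz_real_norm phi (_ * _)) orlicz_real_le//.
  by rewrite normrM (gtr0_norm l0) mulrC -ler_pdivlMr.
Qed.

End counting_slice.

(** A multiple [u] of an indicator with modular above 1 has norm above 1. *)
Lemma orlicz_space_neq0 d (T : measurableType d) (R : realType)
    (mu : {measure set T -> \bar R}) (phi : orliczFunction R) :
  finite_orlicz phi -> sigma_finite setT mu -> (0 < mu setT)%E ->
  exists x : orliczSpace mu phi, x != 0.
Proof.
move=> phi_fin sf mu0.
have [A [mA Afin A0]] : exists A, [/\ measurable A, (mu A < +oo)%E & (0 < mu A)%E].
  have [r r0 rmu] : exists2 r : R, 0 < r & (r%:E < mu setT)%E.
    have [muT|muT] := eqVneq (mu setT) +oo%E; first by exists 1 => //; rewrite muT ltry.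
    have muE : mu setT = (fine (mu setT))%:E by rewrite fineK// ge0_fin_numE// ltey.
    have m0 : 0 < fine (mu setT) by rewrite -lte_fin -muE.
    exists (fine (mu setT) / 2); first by rewrite divr_gt0.
    by rewrite muE lte_fin; lra.
  have [A [mA Afin rA]] := sigma_finite_large_subset sf rmu.
  by exists A; split => //; apply: lt_le_trans rA.
have AE : mu A = (fine (mu A))%:E by rewrite fineK// ge0_fin_numE.
have m0 : 0 < fine (mu A) by rewrite -lte_fin -AE.
have [u u0 Gu] := orlicz_real_unbounded phi_fin (2 / fine (mu A)).
have muu : measurable_fun setT (fun t => u * \1_A t : R).
  by apply: measurable_funM => //; exact: measurable_indic.
have IE : modular mu phi (fun t => u * \1_A t)%R = (orlicz_real phi u * fine (mu A))%:E.
  by rewrite modular_cst_indic ?(ltW u0)// (orlicz_realE phi_fin) ?(ltW u0)// AE -EFinM.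
have [x xR] : exists x : orliczSpace mu phi, represents x (fun t => u * \1_A t).
  by apply: represents_ex => //; apply: finite_modular_lty; rewrite IE ltry.
exists x; apply/eqP => x0; have : `|x| <= 1 by rewrite x0 normr0.
move=> /(norm_le1_modular phi_fin xR); rewrite IE lee_fin leNgt => /negP; apply.
by rewrite -ltr_pdivrMr//; apply: lt_le_trans Gu; rewrite ltr_pM2r ?invr_gt0// ltr1n.
Qed.

Theorem theorem4p18 (R : realType) (phi : orliczFunction R)
    (phi_fin : finite_orlicz phi) :
  (forall (d : measure_display) (T : measurableType d)
      (mu : {measure set T -> \bar R}),
    sigma_finite [set: T] mu -> measure_is_complete mu ->
    (0 < mu [set: T])%E -> nonatomic mu ->
    [/\ SD2P (orliczSpace mu phi) -> D2P (orliczSpace mu phi),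
        D2P (orliczSpace mu phi) -> LD2P (orliczSpace mu phi)
      & N_function_at_infinity phi ->
        [<-> LD2P (orliczSpace mu phi);
             D2P (orliczSpace mu phi);
             SD2P (orliczSpace mu phi);
             ~ Delta2_nonatomic phi mu]]) /\
  [/\ SD2P (orliczSpace (@counting nat R) phi) ->
        D2P (orliczSpace (@counting nat R) phi),
      D2P (orliczSpace (@counting nat R) phi) ->
        LD2P (orliczSpace (@counting nat R) phi)
    & [<-> LD2P (orliczSpace (@counting nat R) phi);
           D2P (orliczSpace (@counting nat R) phi);
           SD2P (orliczSpace (@counting nat R) phi);
           ~ Delta2_zero phi]].
Proof.
split.
  move=> d T mu sf _ mu0 na.
  have sd : SD2P (orliczSpace mu phi) -> D2P (orliczSpace mu phi).
    by apply: SD2P_D2P; exact: orlicz_space_neq0.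
  have nD : ~ Delta2_nonatomic phi mu -> SD2P (orliczSpace mu phi).
    by move=> ?; apply: spread_SD2P; exact: nonatomic_spread.
  split => //; first exact: D2P_LD2P.
  move=> nf; have ld : LD2P (orliczSpace mu phi) -> ~ Delta2_nonatomic phi mu.
    by move=> ld D; exact: (nonatomic_Delta2_not_LD2P phi_fin sf mu0 na nf D ld).
  (* The implications at hand run from [LD2P] to the failure of doubling, then to [SD2P], [D2P] and
     back to [LD2P]; the cycle in the listed order is composed from them. *)
  tfae => [/ld/nD/sd//|d2|s2|/nD/sd/D2P_LD2P//].
    exact/nD/ld/D2P_LD2P.
  exact/ld/D2P_LD2P/sd.
have mu0 : (0 < @counting nat R setT)%E.
  rewrite /counting asboolF ?ltry//; exact: infinite_nat.
have sd : SD2P (orliczSpace (@counting nat R) phi) -> D2P (orliczSpace (@counting nat R) phi).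
  by apply: SD2P_D2P; apply: orlicz_space_neq0 => //; exact: sigma_finite_counting.
have nD : ~ Delta2_zero phi -> SD2P (orliczSpace (@counting nat R) phi).
  by move=> ?; apply: spread_SD2P; exact: counting_spread.
have ld : LD2P (orliczSpace (@counting nat R) phi) -> ~ Delta2_zero phi.
  by move=> ld D; exact: (counting_Delta2_not_LD2P phi_fin D ld).
split => //; first exact: D2P_LD2P.
tfae => [/ld/nD/sd//|d2|s2|/nD/sd/D2P_LD2P//].
  exact/nD/ld/D2P_LD2P.
exact/ld/D2P_LD2P/sd.
Qed.
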